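(* For all $\delta \ge 0$, $K \ge 0$, $\varepsilon>0$, $M\ge 1$ there is a constant $L = L(\delta,K,\varepsilon,M)\ge 1$ with the following property. Let $X$ be a complete geodesic $\delta$-hyperbolic space and let $b \in \hat{\mathcal{B}}(X)$ be such that $X$ is $K$-roughly starlike from the basepoint $\omega$ of $b$. Suppose that $\rho_{\varepsilon,b}(x)=e^{-\varepsilon b(x)}$ is a GH-density with constant $M$. Then the canonical map $\varphi_{\varepsilon,b}: \partial_{\omega}X \rightarrow \partial X_{\varepsilon,b}$ is a well-defined bijection, and under this identification the restriction of $d_{\varepsilon,b}$ to $\partial X_{\varepsilon,b}$ defines a visual metric on $\partial_{\omega}X$ based at $\omega$ with parameter $\varepsilon$ and comparison constant $L$ to the model quasi-metric $\theta_{\varepsilon,b}$; that is, for all $\xi,\zeta\in\partial_\omega X$, $$L^{-1}\theta_{\varepsilon,b}(\xi,\zeta)\le d_{\varepsilon,b}(\varphi_{\varepsilon,b}(\xi),\varphi_{\varepsilon,b}(\zeta))\le L\,\theta_{\varepsilon,b}(\xi,\zeta).$$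
   Context: Hyperbolicity. $(X,d)$ is a metric space, $|xy|=d(x,y)$. A geodesic is an isometric map $\gamma:I\to X$ of an interval $I\subset\mathbb{R}$ (or its image); $X$ is geodesic if any two points are joined by a geodesic. A geodesic space $X$ is $\delta$-hyperbolic if for each geodesic triangle every point of an edge is within distance $\delta$ of the union of the other two edges. The Gromov product is $(x|y)_p=\frac12(|xp|+|yp|-|xy|)$. A sequence $\{x_n\}$ converges to infinity if $(x_n|x_m)_p\to\infty$ as $m,n\to\infty$; the Gromov boundary $\partial X$ is the set of such sequences modulo $\{x_n\}\sim\{y_n\}$ iff $(x_n|y_n)_p\to\infty$ (independent of $p$). We write $\{x_n\}\in\xi$ if $\{x_n\}$ represents $\xi\in\partial X$. A geodesic ray $\gamma:[0,\infty)\to X$ determines the class $[\gamma]\in\partial X$ of $\{\gamma(n)\}$; we write $\gamma\in\xi$ if $[\gamma]=\xi$, and for $\gamma:(-\infty,0]\to X$ we write $\gamma\in\xi$ if $\{\gamma(-n)\}\in\xi$. Busemann functions. For a geodesic ray $\gamma$, $b_\gamma(x)=\lim_{t\to\infty}(d(\gamma(t),x)-t)$. $\mathcal{B}(X)=\{b_\gamma+s\}$ ($\gamma$ a geodesic ray, $s\in\mathbb{R}$); the basepoint of $b=b_\gamma+s$ is $[\gamma]\in\partial X$. $\mathcal{D}(X)=\{d(\cdot,z)+s : z\in X, s\in\mathbb{R}\}$; the basepoint of $b=d(\cdot,z)+s$ is $z$. $\hat{\mathcal{B}}(X)=\mathcal{B}(X)\cup\mathcal{D}(X)$. For $\omega\in\partial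 X$, $\partial_\omega X=\partial X\setminus\{\omega\}$; for $\omega\in X$, $\partial_\omega X=\partial X$. Rough starlikeness. For $z\in X$, $X$ is $K$-roughly starlike from $z$ if (1) for each $x\in X$ there is a geodesic ray $\gamma:[0,\infty)\to X$ with $\gamma(0)=z$ and $\mathrm{dist}(x,\gamma)\le K$; (2) for each $\xi\in\partial X$ there is a geodesic ray $\gamma$ with $\gamma(0)=z$ and $\gamma\in\xi$. For $\omega\in\partial X$, $X$ is $K$-roughly starlike from $\omega$ if (1) for each $x\in X$ there is a geodesic line $\gamma:\mathbb{R}\to X$ with $\mathrm{dist}(x,\gamma)\le K$ and $\gamma|_{(-\infty,0]}\in\omega$; (2) for each $\xi\in\partial_\omega X$ there is a geodesic line $\gamma$ with $\gamma|_{[0,\infty)}\in\xi$ and $\gamma|_{(-\infty,0]}\in\omega$. Conformal deformation. For a continuous $\rho:X\to(0,\infty)$ (a density), $\ell_\rho(\gamma)=\int_\gamma\rho\,ds$ and $X_\rho=(X,d_\rho)$ with $d_\rho(x,y)=\inf\ell_\rho(\gamma)$ over all curves joining $x$ to $y$. $\rho$ is a GH-density with constant $M\ge1$ if $\ell_\rho(\gamma)\le M d_\rho(x,y)$ for all $x,y\in X$ and every geodesic $\gamma$ of $X$ joining $x$ to $y$. $X_{\varepsilon,b}=(X,d_{\varepsilon,b})$ is the conformal deformation with $\rho_{\varepsilon,b}=e^{-\varepsilon b}$; $\bar X_{\varepsilon,b}$ is its completion with extended metric $d_{\varepsilon,b}$, and $\partial X_{\varepsilon,b}=\bar X_{\varepsilon,b}\setminus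 X_{\varepsilon,b}$. Model quasi-metric. For $x,y\in X$, $(x|y)_b=\frac12(b(x)+b(y)-|xy|)$; for $\xi,\zeta\in\partial_\omega X$, $(\xi|\zeta)_b=\inf\liminf_{n\to\infty}(x_n|y_n)_b$, infimum over all $\{x_n\}\in\xi$, $\{y_n\}\in\zeta$. $\theta_{\varepsilon,b}(\xi,\zeta)=e^{-\varepsilon(\xi|\zeta)_b}$ (with $e^{-\infty}=0$). A visual metric on $\partial_\omega X$ based at $\omega$ with parameter $\varepsilon$ and comparison constant $L$ is a metric $\theta$ with $L^{-1}\theta_{\varepsilon,b}\le\theta\le L\theta_{\varepsilon,b}$. Canonical map. $\varphi_{\varepsilon,b}$ sends $\xi\in\partial_\omega X$ to the limit in $\bar X_{\varepsilon,b}$ of any sequence $\{x_n\}\subset X$ with $\{x_n\}\in\xi$. *)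

(* Defs.v *)
From mathcomp Require Import all_boot all_order all_algebra.
From mathcomp Require Import all_classical all_reals all_analysis.

Set Implicit Arguments.
Unset Strict Implicit.
Unset Printing Implicit Defensive.

Import Order.TTheory GRing.Theory Num.Theory.
Import numFieldNormedType.Exports.

Local Open Scope classical_set_scope.
Local Open Scope ring_scope.

Section MetricSpaces.
Context {R : realType} {X : metricType R}.
Implicit Types (x y z p : X) (E : set X) (g : R -> X) (I : set R).

Definition complete_space :=
  forall F : set_system X, ProperFilter F -> cauchy F -> exists x : X, F --> x.

Definition dist_set x E : R := inf [set mdist x y | y in E].

(** Maps defined on an interval [I] are represented by total functions on [R]
    of which only the values on [I] are used. *)
Definition geodesic_on I g :=
  forall s t, I s -> I t -> mdist (g s) (g t) = `|s - t|.

Definition geodesic_joining x y a b g :=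
  [/\ a <= b, geodesic_on `[a, b] g, g a = x & g b = y].

Definition geodesic_space := forall x y, exists a b g, geodesic_joining x y a b g.

Definition geodesic_edge x y E :=
  exists a b g, geodesic_joining x y a b g /\ E = g @` `[a, b].

Definition geodesic_ray g := geodesic_on `[0, +oo[ g.

Definition geodesic_line g := geodesic_on setT g.

Definition hyperbolic (delta : R) :=
  forall x y z E1 E2 E3,
    geodesic_edge x y E1 -> geodesic_edge y z E2 -> geodesic_edge z x E3 ->
  [/\ forall p, E1 p -> dist_set p (E2 `|` E3) <= delta,
      forall p, E2 p -> dist_set p (E3 `|` E1) <= delta &
      forall p, E3 p -> dist_set p (E1 `|` E2) <= delta].

(** Points of the Gromov boundary are equivalence classes, that is, sets of
    sequences: [xi u] reads "the sequence [u] represents [xi]". *)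
Implicit Types (u v : nat -> X) (xi zeta : set (nat -> X)).

Definition gromov_product p x y : R :=
  (mdist x p + mdist y p - mdist x y) / 2.

(** The limits below do not depend on the basepoint [p]. *)
Definition converges_to_infinity u :=
  forall p, gromov_product p (u nm.1) (u nm.2) @[nm --> (\oo, \oo)] --> +oo.

Definition boundary_equiv u v :=
  forall p, gromov_product p (u n) (v n) @[n --> \oo] --> +oo.

Definition boundary_class u : set (nat -> X) :=
  [set v | converges_to_infinity v /\ boundary_equiv u v].

Definition gromov_boundary : set (set (nat -> X)) :=
  [set xi | exists u, converges_to_infinity u /\ xi = boundary_class u].

Definition pos_seq g : nat -> X := fun n => g n%:R.
Definition neg_seq g : nat -> X := fun n => g (- n%:R).

End MetricSpaces.

Arguments complete_space {R} X.
Arguments geodesic_space {R} X.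
Arguments hyperbolic {R} X.
Arguments gromov_boundary {R} X.

Section Busemann.
Context {R : realType} {X : metricType R}.
Implicit Types (x y z : X) (g : R -> X) (xi zeta : set (nat -> X)) (b : X -> R).

Inductive basepoint := Interior of X | AtInfinity of set (nat -> X).

Definition busemann g x : R := lim ((mdist (g t) x - t) @[t --> +oo]).

(** [hatB_based b w]: [b] is in [B(X)] or [D(X)], and [w] is its basepoint. *)
Definition hatB_based b (w : basepoint) :=
  match w with
  | AtInfinity xi => exists g s,
      [/\ geodesic_ray g, xi = boundary_class (pos_seq g) &
          forall x, b x = busemann g x + s]
  | Interior z => exists s, forall x, b x = mdist x z + s
  end.

Definition boundary_minus (w : basepoint) : set (set (nat -> X)) :=
  match w with
  | AtInfinity omega => gromov_boundary X `\ omega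
  | Interior _ => gromov_boundary X
  end.

Definition roughly_starlike (K : R) (w : basepoint) :=
  match w with
  | Interior z =>
      (forall x, exists g,
         [/\ geodesic_ray g, g 0 = z & dist_set x (g @` `[0, +oo[) <= K]) /\
      (forall xi, gromov_boundary X xi -> exists g,
         [/\ geodesic_ray g, g 0 = z & xi (pos_seq g)])
  | AtInfinity omega =>
      (forall x, exists g,
         [/\ geodesic_line g, dist_set x (range g) <= K & omega (neg_seq g)]) /\
      (forall xi, boundary_minus w xi -> exists g,
         [/\ geodesic_line g, xi (pos_seq g) & omega (neg_seq g)])
  end.

Definition gromov_product_at b x y : R := (b x + b y - mdist x y) / 2.

Definition gromov_product_bd b xi zeta : \bar R :=
  ereal_inf [set limn_einf (fun n => (gromov_product_at b (uv.1 n) (uv.2 n))%:E)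
            | uv in xi `*` zeta].

(** [expeR -oo = 0]. *)
Definition model_quasimetric (eps : R) b xi zeta : \bar R :=
  expeR (- (eps%:E * gromov_product_bd b xi zeta))%E.

Definition metric_on (T : Type) (A : set T) (th : T -> T -> R) :=
  [/\ forall p q, A p -> A q -> 0 <= th p q,
      forall p q, A p -> A q -> (th p q = 0 <-> p = q),
      forall p q, A p -> A q -> th p q = th q p &
      forall p q r, A p -> A q -> A r -> th p r <= th p q + th q r].

Definition visual_metric (eps : R) b (w : basepoint) (L : R)
    (th : set (nat -> X) -> set (nat -> X) -> R) :=
  metric_on (boundary_minus w) th /\
  forall xi zeta, boundary_minus w xi -> boundary_minus w zeta ->
    ((L^-1)%:E * model_quasimetric eps b xi zeta <= (th xi zeta)%:E /\
     (th xi zeta)%:E <= L%:E * model_quasimetric eps b xi zeta)%E.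

End Busemann.

Arguments basepoint {R} X.

Section ConformalDeformation.
Context {R : realType} {X : metricType R}.
Implicit Types (x y : X) (a b : R) (g : R -> X) (rho : X -> R).

Definition curve_joining x y a b g :=
  [/\ a <= b, {within `[a, b], continuous g}, g a = x & g b = y].

(** The metric counterpart of [variation] and [total_variation]. *)
Definition polygonal_length a b g (s : seq R) : R :=
  let F := g \o nth b (a :: s) in \sum_(0 <= n < size s) mdist (F n) (F n.+1).

Definition curve_length a b g : \bar R :=
  ereal_sup [set (polygonal_length a b g s)%:E | s in itv_partition a b].

(** The arclength parametrization of a rectifiable curve: the parameter [t] is
    not unique where [g] is locally constant, but [g t] is. *)
Definition arclength_param a b g (s : R) : X :=
  g (get [set t | `[a, b]%classic t /\ curve_length a t g = s%:E]).

Definition rho_length rho a b g : \bar R :=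
  if curve_length a b g is l%:E then
    \int[lebesgue_measure]_(s in `[0, l]) (rho (arclength_param a b g s))%:E
  else +oo%E.

Definition rho_dist rho x y : R :=
  fine (ereal_inf [set l | exists a b g,
    curve_joining x y a b g /\ l = rho_length rho a b g]).

Definition density rho := continuous rho /\ forall x, 0 < rho x.

Definition GH_density rho (M : R) :=
  density rho /\
  forall x y a b g, geodesic_joining x y a b g ->
    (rho_length rho a b g <= (M * rho_dist rho x y)%:E)%E.

Definition rho_eps (eps : R) (b : X -> R) (x : X) : R := expR (- eps * b x).

End ConformalDeformation.

(** The metric completion of [(X, d)]: Cauchy sequences [u] modulo
    [d (u n) (v n) --> 0], a point being represented by its class. *)
Section Completion.
Context {R : realType} {X : Type} (d : X -> X -> R).
Implicit Types (u v : nat -> X) (p q : set (nat -> X)).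

Definition d_cauchy u := d (u nm.1) (u nm.2) @[nm --> (\oo, \oo)] --> (0 : R).

Definition completion_class u : set (nat -> X) :=
  [set v | d_cauchy v /\ d (u n) (v n) @[n --> \oo] --> (0 : R)].

Definition completion : set (set (nat -> X)) :=
  [set p | exists u, d_cauchy u /\ p = completion_class u].

Definition completion_embed (x : X) : set (nat -> X) :=
  completion_class (fun=> x).

(** The limit [r] does not depend on the representatives [u] and [v]. *)
Definition completion_dist p q : R :=
  get [set r | exists u v,
    [/\ p u, q v & d (u n) (v n) @[n --> \oo] --> (r : R)]].

Definition completion_boundary := completion `\` range completion_embed.

Definition completion_limit u p :=
  completion p /\
  completion_dist (completion_embed (u n)) p @[n --> \oo] --> (0 : R).

Definition common_limit (xi : set (nat -> X)) : set (set (nat -> X)) :=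
  [set p | forall u, xi u -> completion_limit u p].

Definition canonical_map (xi : set (nat -> X)) : set (nat -> X) :=
  get (common_limit xi).

End Completion.

(* Main.v *)
(* Write (x|y)_b for the Gromov product based at b. Everything follows from
   c0 e^(-eps (x|y)_b) min(1, |xy|) <= d(x, y) <= c1 e^(-eps (x|y)_b).
   Along a geodesic from x to y, the 1-Lipschitz function b is at least
   (x|y)_b + |s - s0|, where s0 = b x - (x|y)_b, and integrating e^(-eps b)
   gives the upper bound. By hyperbolicity this lower bound of b is sharp up to
   an additive constant, first for distance functions and then, by passing to
   the limit, for Busemann functions; the GH inequality turns this into the lower
   bound for d.
   A sequence representing a point xi <> omega satisfies (x_n|x_m)_b -> oo, so it
   is d-Cauchy. Conversely a d-Cauchy sequence without limit in X satisfies
   b(x_n) -> oo (otherwise the lower bound makes it Cauchy in X), hence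
   (x_n|x_m)_b -> oo, and represents a point of the boundary other than omega.
   If x_n -> xi and y_n -> zeta with xi <> zeta, then |x_n y_n| >= 1 eventually
   and d(x_n, y_n) is comparable to e^(-eps (x_n|y_n)_b) for every choice of the
   two sequences, which compares the limit distance with the model quasi-metric.
   That d is a metric at all rests on replacing curves by their unit-speed
   reparametrizations, which can be reversed and concatenated. *)
Require Import Defs.
From mathcomp Require Import all_boot all_order all_algebra.
From mathcomp Require Import all_classical all_reals all_analysis.
From mathcomp Require Import ring lra.

Set Implicit Arguments.
Unset Strict Implicit.
Unset Printing Implicit Defensive.

Import Order.TTheory GRing.Theory Num.Theory.
Import numFieldNormedType.Exports.

Local Open Scope classical_set_scope.
Local Open Scope ring_scope.

(** * Length of curves and arclength parametrization *)

Section CurveLength.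
Context {R : realType} {X : metricType R}.
Implicit Types (a b s t x y z : R) (g : R -> X).

(** A recursive form of [polygonal_length], so that partitions can be handled by induction on the
    list. *)
Fixpoint chain_length g x (l : seq R) : R :=
  if l is y :: l' then mdist (g x) (g y) + chain_length g y l' else 0.

Lemma polygonal_lengthE a b g l : polygonal_length a b g l = chain_length g a l.
Proof.
rewrite /polygonal_length; elim: l a => [|y l IHl] a /=; first by rewrite big_geq.
by rewrite big_nat_recl// -IHl.
Qed.

Lemma chain_length_le a b g l : itv_partition a b l ->
  ((chain_length g a l)%:E <= curve_length a b g)%E.
Proof.
by move=> p; apply: ereal_sup_ubound; exists l => //; rewrite polygonal_lengthE.
Qed.

Lemma curve_lengthxx a g : curve_length a a g = 0%E.
Proof.
rewrite /curve_length; apply/eqP; rewrite eq_le; apply/andP; split.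
  apply: ge_ereal_sup => _ [l /itv_partitionxx -> <-].
  by rewrite polygonal_lengthE.
by have := @chain_length_le a a g [::]; apply; split.
Qed.

Lemma mdist_le_curve_length a b g : a <= b ->
  ((mdist (g a) (g b))%:E <= curve_length a b g)%E.
Proof.
rewrite le_eqVlt => /predU1P[->|ab]; first by rewrite curve_lengthxx mdistxx.
by have := chain_length_le g (itv_partition1 ab); rewrite /= addr0.
Qed.

Lemma curve_length_ge0 a b g : a <= b -> (0 <= curve_length a b g)%E.
Proof.
by move=> ab; apply: le_trans (mdist_le_curve_length g ab); rewrite lee_fin mdist_ge0.
Qed.

(** Inserting [b] into the partition only increases the sum, by the triangle inequality on the edge
    that straddles [b]. *)
Lemma chain_length_split a b g l : path <%R a l -> a <= b -> b <= last a l ->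
  ((chain_length g a l)%:E <= curve_length a b g + curve_length b (last a l) g)%E.
Proof.
elim: l a => [|y l IHl] a /=.
  by move=> _ ab ba; rewrite adde_ge0// curve_length_ge0.
move=> /andP[ay yl] ab bl; have [yb|/ltW by_] := leP y b.
  rewrite EFinD; apply: (le_trans (leeD2l _ (IHl _ yl yb bl))).
  rewrite addeA leeD2r// /curve_length.
  have Hne : [set (polygonal_length y b g s)%:E | s in itv_partition y b] !=set0.
    move: yb; rewrite le_eqVlt => /predU1P[->|yb].
      by exists (polygonal_length b b g [::])%:E; exists [::] => //; split.
    by exists (polygonal_length y b g [:: b])%:E; exists [:: b] => //; exact: itv_partition1.
  rewrite -leeBrDl//.
  apply: ge_ereal_sup => _ [s [ys /eqP sb] <-].
  rewrite leeBrDl// -EFinD polygonal_lengthE.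
  by apply: (@chain_length_le a b g (y :: s)); split => /=; [rewrite ay|apply/eqP].
rewrite EFinD.
move: by_; rewrite le_eqVlt => /predU1P[->|by_].
  by rewrite leeD ?mdist_le_curve_length// ?(ltW ay)//; apply: chain_length_le; split.
apply: (@le_trans _ _ ((mdist (g a) (g b))%:E + (chain_length g b (y :: l))%:E)%E).
  by rewrite -!EFinD lee_fin /= addrA lerD2r metric_triangle.
rewrite leeD ?mdist_le_curve_length//; apply: chain_length_le; split => //=.
by rewrite by_.
Qed.

Lemma chain_length_cat g x l1 l2 :
  chain_length g x (l1 ++ l2) = chain_length g x l1 + chain_length g (last x l1) l2.
Proof. by elim: l1 x => [|y l1 IH] x /=; rewrite ?add0r// IH addrA. Qed.

(** One inequality inserts [b] into a partition, the other concatenates two partitions and takes the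
    suprema one after the other. Each supremum is isolated by a subtraction, so infinite lengths are
    treated apart. *)
Lemma curve_lengthD a b c g : a <= b -> b <= c ->
  curve_length a c g = (curve_length a b g + curve_length b c g)%E.
Proof.
move=> ab bc; apply/eqP; rewrite eq_le; apply/andP; split.
  apply: ge_ereal_sup => _ [l [al /eqP lc] <-]; rewrite polygonal_lengthE.
  by rewrite -[X in curve_length b X]lc; apply: chain_length_split => //; rewrite lc.
have [->|/eqP fab] := pselect (curve_length a c g = +oo%E); first by rewrite leey.
have key l1 l2 : itv_partition a b l1 -> itv_partition b c l2 ->
    ((chain_length g a l1)%:E + (chain_length g b l2)%:E <= curve_length a c g)%E.
  move=> p1 p2; have := itv_partition_cat p1 p2 => /(chain_length_le g).
  by rewrite chain_length_cat; case: p1 => _ /eqP ->; rewrite EFinD.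
have f2 l1 : itv_partition a b l1 ->
  ((chain_length g a l1)%:E + curve_length b c g <= curve_length a c g)%E.
  move=> p1; rewrite -leeBrDl//; apply: ge_ereal_sup => _ [l2 p2 <-].
  by rewrite leeBrDl// polygonal_lengthE key.
have [bco|/eqP fbc] := pselect (curve_length b c g = +oo%E).
  case: (ltgtP a b) ab => // [ab _|-> _].
    by have := f2 _ (itv_partition1 ab); rewrite bco addey// leye_eq => /eqP ->; rewrite leey.
  by rewrite curve_lengthxx add0e.
have fin_bc : curve_length b c g \is a fin_num.
  by rewrite ge0_fin_numE ?curve_length_ge0// ltey.
rewrite -leeBrDr//; apply: ge_ereal_sup => _ [l1 p1 <-].
by rewrite leeBrDr// polygonal_lengthE f2.
Qed.

(** Length is the least superadditive function of intervals that dominates the distance of the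
    endpoints. The bounds below for Lipschitz curves, reparametrizations and reflections are
    instances, each with its own [F]. *)
Lemma curve_length_le_superadditive a b g (F : R -> R -> \bar R) : a <= b ->
  (forall x, a <= x <= b -> (0 <= F x x)%E) ->
  (forall x y, a <= x -> x < y -> y <= b -> ((mdist (g x) (g y))%:E <= F x y)%E) ->
  (forall x y z, a <= x -> x <= y -> y <= z -> z <= b -> (F x y + F y z <= F x z)%E) ->
  (curve_length a b g <= F a b)%E.
Proof.
move=> ab F0 F1 F2; apply: ge_ereal_sup => _ [l [al /eqP lb] <-].
rewrite polygonal_lengthE.
(* This copy of [a <= a] lets the induction move the start of the chain while the lower bound [a]
   stays fixed. *)
have : a <= a by []; rewrite -[X in F _ X]lb.
elim: l {-3}a al lb => [x _ /= -> _ |y l IH x /= /andP[xy yl] lb ax].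
  by apply: F0; rewrite ab lexx.
have yb : y <= b by rewrite -lb; apply: (@itv_partition_le _ _ _ _ l); split.
have ay : a <= y by rewrite (le_trans ax)// ltW.
rewrite EFinD.
apply: le_trans (F2 x y _ ax (ltW xy) _ _); rewrite ?lb//.
by apply: leeD; [exact: F1|rewrite -[X in F _ X]lb; exact: IH].
Qed.

Lemma curve_length_Lipschitz a b g : a <= b ->
  (forall s t, a <= s -> s < t -> t <= b -> mdist (g s) (g t) <= t - s) ->
  (curve_length a b g <= (b - a)%:E)%E.
Proof.
move=> ab gL; apply: (@curve_length_le_superadditive a b g (fun x y => (y - x)%:E)) => //.
- by move=> x _; rewrite subrr.
- by move=> x y z _ _ _ _; rewrite -EFinD lee_fin addrC subrKA.
Qed.

(** A monotone [f] may skip parts of [h], whence only an inequality; used for a map and for its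
    inverse it yields equalities. *)
Lemma curve_length_le_comp a b g h (f : R -> R) : a <= b ->
  (forall s t, a <= s -> s <= t -> t <= b -> f s <= f t) ->
  (forall s, a <= s <= b -> g s = h (f s)) ->
  (curve_length a b g <= curve_length (f a) (f b) h)%E.
Proof.
move=> ab fm gE.
apply: (@curve_length_le_superadditive a b g (fun x y => curve_length (f x) (f y) h)) => //.
- by move=> x _; rewrite curve_length_ge0.
- move=> x y ax xy yb; rewrite !gE ?ax ?(le_trans (ltW xy))//.
    by rewrite mdist_le_curve_length// fm// ltW.
  by rewrite (le_trans ax (ltW xy)).
- move=> x y z ax xy yz zb; rewrite [leRHS](@curve_lengthD (f x) (f y))//.
  + by rewrite fm// (le_trans yz).
  + by rewrite fm// (le_trans ax).
Qed.

Lemma eq_curve_length a b g h : a <= b -> (forall s, a <= s <= b -> g s = h s) ->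
  curve_length a b g = curve_length a b h.
Proof.
move=> ab gh; apply/eqP; rewrite eq_le.
by rewrite !(@curve_length_le_comp _ _ _ _ id)// => s /gh.
Qed.

Lemma curve_length_shift a b g c : a <= b ->
  curve_length a b (fun t => g (t + c)) = curve_length (a + c) (b + c) g.
Proof.
move=> ab; apply/eqP; rewrite eq_le (@curve_length_le_comp _ _ _ g (fun t => t + c))//=.
  rewrite -{2}[a](addrK c) -{2}[b](addrK c).
  apply: (@curve_length_le_comp _ _ _ _ (fun t => t - c)); rewrite ?lerD2r//.
  - by move=> s t; rewrite lerD2r.
  - by move=> s _; rewrite subrK.
by move=> s t; rewrite lerD2r.
Qed.

Let curve_lengthN_le a b g : a <= b ->
  (curve_length a b g <= curve_length (- b) (- a) (g \o -%R))%E.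
Proof.
move=> ab.
apply: (@curve_length_le_superadditive a b g
  (fun x y => curve_length (- y) (- x) (g \o -%R))) => //.
- by move=> x _; rewrite curve_length_ge0.
- move=> x y ax xy yb.
  have := @mdist_le_curve_length (- y) (- x) (g \o -%R).
  by rewrite /= !opprK metric_sym; apply; rewrite lerN2 ltW.
- by move=> x y z ax xy yz zb; rewrite addeC -curve_lengthD// lerN2.
Qed.

Lemma curve_lengthN a b g : a <= b ->
  curve_length a b (g \o -%R) = curve_length (- b) (- a) g.
Proof.
move=> ab; apply/eqP; rewrite eq_le; apply/andP; split.
  apply: le_trans (curve_lengthN_le _ ab) _.
  rewrite (_ : (g \o -%R) \o -%R = g)//.
  by apply/funext => x /=; rewrite opprK.
by have := @curve_lengthN_le (- b) (- a) g; rewrite !opprK lerN2; apply.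
Qed.

Lemma within_itv_continuousP a b g : {within `[a, b], continuous g} <->
  forall x, a <= x <= b -> forall e, 0 < e -> exists2 eta, 0 < eta &
    forall t, a <= t <= b -> `|x - t| < eta -> mdist (g x) (g t) < e.
Proof.
split.
  move=> /subspace_continuousP cg x xab e e0.
  have /cg/metricType_numDomainType.cvgrPdist_lt/(_ _ e0) : `[a, b]%classic x.
    by rewrite /= in_itv.
  rewrite near_withinE => /nbhs_ballP[eta /= eta0 H]; exists eta => //.
  by move=> t tab xt; apply: H => //=; rewrite in_itv.
move=> H; apply/subspace_continuousP => x xab.
apply/metricType_numDomainType.cvgrPdist_lt => e e0.
have [|eta eta0 Heta] := H x _ e e0; first by move: xab; rewrite /= in_itv.
rewrite near_withinE; apply/nbhs_ballP; exists eta => //= t xt.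
by rewrite in_itv/= => tab; exact: Heta.
Qed.

(* Drop the first edge, which becomes short, of an almost optimal chain. *)
Lemma curve_length_right_small a b g (e : R) : a < b ->
  {within `[a, b], continuous g} -> curve_length a b g \is a fin_num -> 0 < e ->
  exists2 eta, 0 < eta &
    forall t, a <= t -> t < a + eta -> t <= b -> (curve_length a t g < e%:E)%E.
Proof.
move=> ab cg fg e0.
have e20 : 0 < e / 2 by rewrite divr_gt0.
have [_ [l [al /eqP lb] <-]] := ub_ereal_sup_adherent e20 fg.
rewrite -/(curve_length a b g) polygonal_lengthE => le.
case: l al lb le => [_ /= lb|y l /= /andP[ay yl] lb le]; first by rewrite lb ltxx in ab.
have aab : a <= a <= b by rewrite lexx ltW.
have [eta eta0 Heta] := (within_itv_continuousP a b g).1 cg a aab _ e20.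
exists (Num.min eta (y - a)); first by rewrite lt_min eta0 subr_gt0.
move=> t at_ + tb; rewrite -ltrBlDl lt_min => /andP[t1 t2].
move: at_; rewrite le_eqVlt => /predU1P[<-|at_]; first by rewrite curve_lengthxx.
have ty : t < y by move: t2; rewrite ltrD2r.
have gat : mdist (g a) (g t) < e / 2.
  by apply: Heta; rewrite ?(ltW at_)// distrC ger0_norm// subr_ge0 (ltW at_).
have : ((chain_length g t (y :: l))%:E <= curve_length t b g)%E.
  by apply: chain_length_le; split; [rewrite /= ty|apply/eqP].
move: le; rewrite (curve_lengthD g (ltW at_) tb).
have ft : curve_length a t g \is a fin_num.
  move: fg; rewrite (curve_lengthD g (ltW at_) tb) fin_numD => /andP[]//.
have fb : curve_length t b g \is a fin_num.
  move: fg; rewrite (curve_lengthD g (ltW at_) tb) fin_numD => /andP[]//.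
rewrite -(fineK ft) -(fineK fb) -!EFinD !lte_fin !lee_fin /= => h1 h2.
have := metric_triangle (g a) (g t) (g y); lra.
Qed.

Lemma curve_length_sub_fin a b s t g : a <= s -> s <= t -> t <= b ->
  curve_length a b g \is a fin_num -> curve_length s t g \is a fin_num.
Proof.
move=> as_ st tb; rewrite (curve_lengthD g as_ (le_trans st tb)) (curve_lengthD g st tb).
by rewrite !fin_numD => /andP[_ /andP[]].
Qed.

(** The reflection of the parameter turns this into the smallness of initial arcs. *)
Lemma curve_length_left_small a b g (e : R) : a < b ->
  {within `[a, b], continuous g} -> curve_length a b g \is a fin_num -> 0 < e ->
  exists2 eta, 0 < eta &
    forall t, t <= b -> b - eta < t -> a <= t -> (curve_length t b g < e%:E)%E.
Proof.
move=> ab cg fg e0.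
have [||||eta eta0 H] := @curve_length_right_small (- b) (- a) (g \o -%R) e => //.
- by rewrite ltrN2.
- apply/within_itv_continuousP => x xab e' e'0.
  have [|eta eta0 H] := (within_itv_continuousP a b g).1 cg (- x) _ e' e'0.
    by rewrite lerNr lerNl andbC.
  exists eta => // t tab xt; apply: H; first by rewrite lerNr lerNl andbC.
  by rewrite -opprD normrN.
- by rewrite curve_lengthN ?lerN2 ?ltW// !opprK.
exists eta => // t tb bt at_.
by have := H (- t); rewrite !lerN2 ltrNl opprD opprK => /(_ tb bt at_);
  rewrite curve_lengthN ?lerN2// !opprK.
Qed.

Lemma fine_curve_lengthB a b s t g : a <= s -> s <= t -> t <= b ->
  curve_length a b g \is a fin_num ->
  curve_length s t g = (fine (curve_length a t g) - fine (curve_length a s g))%:E.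
Proof.
move=> as_ st tb fg.
have fs : curve_length a s g \is a fin_num.
  exact: (curve_length_sub_fin (lexx a) as_ (le_trans st tb) fg).
have ft := curve_length_sub_fin as_ st tb fg.
by rewrite (curve_lengthD g as_ st) fineD// addrAC subrr add0r fineK.
Qed.

(** By additivity the increments are lengths of short arcs to the left or to the right of the point,
    and these are small. At an end of the interval one of the two sides is trivial. *)
Lemma curve_length_continuous a b g : a <= b ->
  {within `[a, b], continuous g} -> curve_length a b g \is a fin_num ->
  {within `[a, b], continuous (fun t => fine (curve_length a t g))}.
Proof.
move=> ab cg fg; apply/subspace_continuousP => x; rewrite /= in_itv /= => /andP[ax xb].
apply/cvgrPdist_lt => e e0; rewrite near_withinE.
have [etal etal0 Hl] : exists2 eta, 0 < eta &
    forall t, t <= x -> x - eta < t -> a <= t -> (curve_length t x g < e%:E)%E.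
  move: (ax); rewrite le_eqVlt => /predU1P[<-|ax'].
    exists 1 => // t ta _ at_; have -> : t = a by apply/eqP; rewrite eq_le ta.
    by rewrite curve_lengthxx.
  apply: curve_length_left_small => //; last exact: (curve_length_sub_fin _ _ _ fg).
  apply: continuous_subspaceW cg => t /=; rewrite !in_itv/= => /andP[-> tx].
  exact: le_trans xb.
have [etar etar0 Hr] : exists2 eta, 0 < eta &
    forall t, x <= t -> t < x + eta -> t <= b -> (curve_length x t g < e%:E)%E.
  move: (xb); rewrite le_eqVlt => /predU1P[->|xb'].
    exists 1 => // t ta _ at_; have -> : t = b by apply/eqP; rewrite eq_le ta at_.
    by rewrite curve_lengthxx.
  apply: curve_length_right_small => //; last exact: (curve_length_sub_fin _ _ _ fg).
  apply: continuous_subspaceW cg => t /=; rewrite !in_itv/= => /andP[tx ->].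
  by rewrite andbT (le_trans ax).
apply/nbhs_ballP; exists (Num.min etal etar); first by rewrite /= lt_min etal0.
move=> t /=; rewrite /ball/= lt_min in_itv/= => /andP[xtl xtr] /andP[at_ tb].
pose F t := fine (curve_length a t g); rewrite -[X in X < _]/(`|F x - F t|).
have [tx|/ltW xt] := leP t x.
  rewrite ger0_norm ?subr_ge0// in xtl.
  have := Hl t tx; rewrite ltrBlDr -ltrBlDl => /(_ xtl at_).
  have := curve_length_ge0 g tx.
  rewrite (fine_curve_lengthB at_ tx xb fg) lee_fin lte_fin => F0.
  by rewrite ger0_norm.
rewrite distrC ger0_norm ?subr_ge0// in xtr.
have := Hr t xt; rewrite -ltrBlDl => /(_ xtr tb).
have := curve_length_ge0 g xt.
rewrite (fine_curve_lengthB ax xt tb fg) lee_fin lte_fin => F0.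
by rewrite distrC ger0_norm.
Qed.

Lemma curve_length_surj a b g l s : a <= b ->
  {within `[a, b], continuous g} -> curve_length a b g = l%:E -> 0 <= s <= l ->
  exists2 t, a <= t <= b & curve_length a t g = s%:E.
Proof.
move=> ab cg gl /andP[s0 sl].
have fg : curve_length a b g \is a fin_num by rewrite gl.
have [|t] := IVT ab (@curve_length_continuous a b g ab cg fg) (v := s).
  by rewrite curve_lengthxx gl /= minEle maxEle (le_trans s0 sl) s0.
rewrite in_itv/= => tab <-; exists t => //; rewrite fineK//.
by move/andP: tab => [? ?]; apply: (curve_length_sub_fin _ _ _ fg).
Qed.

(** The choice made by [get] is harmless: two parameters with the same arclength bound an arc of
    length 0, so [g] takes the same value at both. *)
Lemma arclength_paramE a b g t s : a <= t <= b -> curve_length a t g = s%:E ->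
  arclength_param a b g s = g t.
Proof.
move=> tab ts; rewrite /arclength_param.
set P := [set t | _ /\ _]; have : P (get P).
  by apply: getPex; exists t; split => /=; rewrite ?in_itv.
move: (get P) => t' [/=]; rewrite in_itv/= => tab' ts'.
wlog tt' : t t' tab tab' ts ts' / t <= t'.
  by move=> H; have [/H|/ltW/H] := leP t t'; last (move=> H'; apply/esym; move: H'); apply.
have /andP[at_ _] := tab.
have := @mdist_le_curve_length t t' g tt'.
suff -> : curve_length t t' g = 0%E.
  rewrite lee_fin => h; apply/esym/mdist_positivity/eqP.
  by rewrite eq_le h mdist_ge0.
move: ts'; rewrite (curve_lengthD g at_ tt') ts.
by case: (curve_length t t' g) => //= r [] h; congr EFin; lra.
Qed.

(** A condition on lengths of subarcs rather than on distances, so that it is stable under reversal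
    and concatenation. *)
Definition unit_speed a b (c : R -> X) :=
  forall s t, a <= s -> s <= t -> t <= b -> curve_length s t c = (t - s)%:E.

Lemma geodesic_unit_speed a b g : geodesic_on `[a, b] g -> unit_speed a b g.
Proof.
move=> gg s t as_ st tb.
have gE u v : s <= u -> u <= v -> v <= t -> mdist (g u) (g v) = v - u.
  move=> su uv vt; rewrite gg/= ?in_itv/=.
  - by rewrite distrC ger0_norm// subr_ge0.
  - by rewrite (le_trans as_ su) (le_trans uv (le_trans vt tb)).
  - by rewrite (le_trans as_ (le_trans su uv)) (le_trans vt tb).
apply/eqP; rewrite eq_le curve_length_Lipschitz//=; last first.
  by move=> u v su uv vt; rewrite gE ?(ltW uv).
by rewrite -(gE s t)// mdist_le_curve_length.
Qed.

Lemma unit_speed_Lipschitz a b c : unit_speed a b c ->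
  forall s t, a <= s -> s <= t -> t <= b -> mdist (c s) (c t) <= t - s.
Proof.
move=> cu s t as_ st tb; rewrite -lee_fin -(cu s t)//.
exact: mdist_le_curve_length.
Qed.

Lemma unit_speed_continuous a b c : unit_speed a b c -> {within `[a, b], continuous c}.
Proof.
move=> /unit_speed_Lipschitz cL; apply/within_itv_continuousP => x /andP[ax xb] e e0.
exists e => // t /andP[at_ tb] xt; apply: le_lt_trans xt.
have [xt|/ltW tx] := leP x t; first by rewrite distrC ger0_norm ?subr_ge0 ?cL.
by rewrite ger0_norm ?subr_ge0// metric_sym cL.
Qed.

(** The length function [lam] maps [a, b] monotonically onto [0, l], and [c] after [lam] is [g].
    Hence [c] is 1-Lipschitz, which bounds its lengths from above; and arcs of [g] are monotone
    reparametrizations of arcs of [c], which bounds them from below. *)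
Lemma unit_speed_arclength a b g l : a <= b ->
  {within `[a, b], continuous g} -> curve_length a b g = l%:E ->
  let c := arclength_param a b g in
  [/\ 0 <= l, unit_speed 0 l c, c 0 = g a & c l = g b].
Proof.
move=> ab cg gl c.
have l0 : 0 <= l by rewrite -lee_fin -gl curve_length_ge0.
have fg : curve_length a b g \is a fin_num by rewrite gl.
split => //; last 2 first.
- by apply: arclength_paramE; rewrite ?lexx ?ab ?curve_lengthxx.
- by apply: arclength_paramE; rewrite ?lexx ?ab ?gl.
pose lam t := fine (curve_length a t g).
have lamD u v : a <= u -> u <= v -> v <= b ->
    curve_length u v g = (lam v - lam u)%:E.
  by move=> au uv vb; exact: fine_curve_lengthB vb fg.
have lam_mono u v : a <= u -> u <= v -> v <= b -> lam u <= lam v.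
  by move=> au uv vb; rewrite -subr_ge0 -lee_fin -lamD// curve_length_ge0.
have cE u : a <= u <= b -> c (lam u) = g u.
  move=> uab; apply: arclength_paramE => //; rewrite fineK//.
  by case/andP: uab => *; apply: (curve_length_sub_fin _ _ _ fg).
have surj s : 0 <= s <= l -> exists2 t, a <= t <= b & lam t = s.
  move=> /(curve_length_surj ab cg gl)[t tab ts]; exists t => //.
  by rewrite /lam ts.
have lt_lam u v : a <= u <= b -> a <= v <= b -> lam u < lam v -> u <= v.
  move=> /andP[au ub] /andP[av vb]; rewrite leNgt => uv; apply/negP => vu.
  by move: uv; rewrite ltNge lam_mono// ltW.
move=> s t s0 st tl.
have [u uab us] := surj s (introT andP (conj s0 (le_trans st tl))).
have [v vab vt] := surj t (introT andP (conj (le_trans s0 st) tl)).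
apply/eqP; rewrite eq_le; apply/andP; split.
  apply: curve_length_Lipschitz => // s' t' ss' st' tt'.
  have [|u' u'ab us'] := surj s'.
    by rewrite (le_trans s0 ss') (le_trans (ltW st') (le_trans tt' tl)).
  have [|v' v'ab vt'] := surj t'.
    by rewrite (le_trans s0 (le_trans ss' (ltW st'))) (le_trans tt' tl).
  have uv' : u' <= v' by apply: lt_lam => //; rewrite us' vt'.
  rewrite -us' -vt' !cE// -lee_fin -lamD; last 3 first.
  - by case/andP : u'ab.
  - by [].
  - by case/andP : v'ab.
  exact: mdist_le_curve_length.
move: st; rewrite [s <= t]le_eqVlt => /predU1P[->|st]; first by rewrite subrr curve_lengthxx.
have uv : u <= v by apply: lt_lam => //; rewrite us vt.
case/andP : uab => au ub; case/andP : vab => av vb.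
rewrite -us -vt -lamD//; apply: curve_length_le_comp => //.
- move=> u' v' uu' uv' vv'; apply: lam_mono => //; last exact: le_trans vb.
  exact: le_trans uu'.
- move=> s' /andP[us' s'v]; rewrite cE//.
  by rewrite (le_trans au us') (le_trans s'v vb).
Qed.

End CurveLength.

(** * Translation and reflection of integrals over intervals *)

Section IntegralSubstitution.
Context {R : realType}.
Local Notation mu := (@lebesgue_measure R).

Lemma Rintegral_itv_shift (f : R -> R) (a b r : R) : a <= b ->
  {within `[a + r, b + r], continuous f} ->
  \int[mu]_(x in `[a + r, b + r]) f x = \int[mu]_(x in `[a, b]) f (x + r).
Proof.
move=> ab cf; rewrite /Rintegral.
have dF x : is_derive x (1 : R) (fun x => x + r) 1.
  by apply: is_derive_eq; rewrite addr0.
have dE : derive1 (fun x : R => x + r) = cst 1.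
  by apply/funext => x; rewrite derive1E derive_val.
rewrite (@integration_by_substitution_increasing R (fun x => x + r) f a b)//.
- congr fine; apply: eq_integral => x _.
  by rewrite !fctE dE /= mulr1.
- by move=> x y _ _; rewrite ltrD2r.
- by move=> x _; rewrite dE; exact: cvg_cst.
- by rewrite dE; exact: is_cvg_cst.
- by rewrite dE; exact: is_cvg_cst.
- split.
  + by move=> x _; exact: ex_derive.
  + by apply: cvg_at_right_filter; apply: cvgD => //; exact: cvg_cst.
  + by apply: cvg_at_left_filter; apply: cvgD => //; exact: cvg_cst.
Qed.

Lemma Rintegral_itv_opp (f : R -> R) (a b : R) : a <= b ->
  {within `[- b, - a], continuous f} ->
  \int[mu]_(x in `[- b, - a]) f x = \int[mu]_(x in `[a, b]) f (- x).
Proof. by move=> ab cf; rewrite /Rintegral integration_by_substitution_oppr. Qed.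

Lemma integrable_itv_continuous (f : R -> R) (a b : R) :
  {within `[a, b], continuous f} -> mu.-integrable `[a, b] (EFin \o f).
Proof.
by move=> cf; apply: continuous_compact_integrable => //; exact: segment_compact.
Qed.

End IntegralSubstitution.

(** * The distance of a density through unit-speed curves, and its pseudometric axioms *)

Section UnitSpeed.
Context {R : realType} {X : metricType R}.
Implicit Types (a b l r s t : R) (x y z : X) (c g : R -> X).

Lemma unit_speed_shift a b r c : unit_speed (a + r) (b + r) c ->
  unit_speed a b (fun t => c (t + r)).
Proof.
move=> cu s t as_ st tb; rewrite curve_length_shift// cu ?lerD2r//.
by congr EFin; lra.
Qed.

Lemma unit_speed_opp a b c : unit_speed (- b) (- a) c -> unit_speed a b (c \o -%R).
Proof.
move=> cu s t as_ st tb; rewrite curve_lengthN// cu ?lerN2//.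
by congr EFin; lra.
Qed.

Lemma unit_speed_rev l c : unit_speed 0 l c -> unit_speed 0 l (fun t => c (- t + l)).
Proof.
move=> cu; apply: (@unit_speed_opp 0 l (fun t => c (t + l))).
by apply: unit_speed_shift; rewrite addNr oppr0 add0r.
Qed.

Definition concat l (c1 c2 : R -> X) s := if s <= l then c1 s else c2 (s - l).

Lemma concatE2 l c1 c2 s : c1 l = c2 0 -> l <= s -> concat l c1 c2 s = c2 (s - l).
Proof.
move=> c12; rewrite /concat le_eqVlt => /predU1P[<-|]; first by rewrite lexx subrr.
by rewrite ltNge => /negbTE ->.
Qed.

Lemma unit_speed_concat l1 l2 c1 c2 : c1 l1 = c2 0 ->
  unit_speed 0 l1 c1 -> unit_speed 0 l2 c2 ->
  unit_speed 0 (l1 + l2) (concat l1 c1 c2).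
Proof.
move=> c12 u1 u2 s t s0 st tl.
have L1 u v : 0 <= u -> u <= v -> v <= l1 ->
    curve_length u v (concat l1 c1 c2) = (v - u)%:E.
  move=> u0 uv vl; rewrite -u1//; apply: eq_curve_length => // w /andP[_ wv].
  by rewrite /concat (le_trans wv vl).
have L2 u v : l1 <= u -> u <= v -> v <= l1 + l2 ->
    curve_length u v (concat l1 c1 c2) = (v - u)%:E.
  move=> lu uv vl.
  rewrite (@eq_curve_length _ _ _ _ _ (fun t => c2 (t - l1)))//; last first.
    by move=> w /andP[uw wv]; rewrite concatE2// (le_trans lu).
  rewrite curve_length_shift// u2.
  - by congr EFin; lra.
  - by rewrite subr_ge0.
  - by rewrite lerD2r.
  - by rewrite lerBlDl.
have [tl1|/ltW l1t] := leP t l1; first exact: L1.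
have [l1s|/ltW sl1] := leP l1 s; first exact: L2.
rewrite (curve_lengthD _ sl1 l1t) L1// L2// -EFinD.
by congr EFin; lra.
Qed.

Definition rho_int (rho : X -> R) l c := \int[lebesgue_measure]_(s in `[0, l]) rho (c s).

Section Density.
Variable rho : X -> R.
Hypotheses (crho : continuous rho) (rho0 : forall x, 0 < rho x).

Lemma unit_speed_rho_continuous a b c : unit_speed a b c ->
  {within `[a, b], continuous (rho \o c)}.
Proof.
move=> /unit_speed_continuous cc x.
apply: (@continuous_comp (subspace `[a, b]) X R c rho x); [exact: cc|exact: crho].
Qed.

Lemma rho_int_ge0 l c : 0 <= rho_int rho l c.
Proof. by apply: Rintegral_ge0 => s _; rewrite ltW. Qed.

Lemma rho_int_rev l c : 0 <= l -> unit_speed 0 l c ->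
  rho_int rho l (fun t => c (- t + l)) = rho_int rho l c.
Proof.
move=> l0 cu.
have cu' : unit_speed (- l + l) (0 + l) c by rewrite addNr add0r.
rewrite /rho_int -(@Rintegral_itv_opp _ (fun t => rho (c (t + l))))//; last first.
  apply: (@unit_speed_rho_continuous _ _ (fun t => c (t + l))).
  by apply: unit_speed_shift; rewrite oppr0.
rewrite oppr0 -(@Rintegral_itv_shift _ (rho \o c)) ?oppr_le0//.
  by rewrite addNr add0r.
exact: unit_speed_rho_continuous.
Qed.

Lemma rho_int_concat l1 l2 c1 c2 : 0 <= l1 -> 0 <= l2 -> c1 l1 = c2 0 ->
  unit_speed 0 l1 c1 -> unit_speed 0 l2 c2 ->
  rho_int rho (l1 + l2) (concat l1 c1 c2) = rho_int rho l1 c1 + rho_int rho l2 c2.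
Proof.
move=> l10 l20 c12 u1 u2; set c := concat l1 c1 c2.
have cu : unit_speed 0 (l1 + l2) c by exact: unit_speed_concat.
have ci := integrable_itv_continuous (unit_speed_rho_continuous cu).
have := @Rintegral_itvB R (rho \o c) (BLeft 0) (BRight (l1 + l2)) l1 ci.
rewrite !bnd_simp => /(_ l10); rewrite lerDl => /(_ l20).
have ci2 : lebesgue_measure.-integrable `]l1, l1 + l2] (EFin \o (rho \o c)).
  apply: integrableS ci => //; apply: subset_itvr; rewrite bnd_simp//.
(* The difference of integrals lives on a half-open interval; the point [l1] is null and is added
   back before the shift. *)
rewrite (Rintegral_itv_obnd_cbnd ci2).
rewrite (_ : `[l1, l1 + l2]%classic = `[0 + l1, l2 + l1]%classic); last first.
  by rewrite add0r addrC.
rewrite Rintegral_itv_shift//; last first.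
  rewrite add0r addrC; apply: unit_speed_rho_continuous => s t s0 st tl.
  by apply: cu => //; exact: le_trans s0.
move=> /(canRL (subrK _)) h; apply: (eq_trans h); rewrite addrC; congr +%R.
  apply: eq_Rintegral => s; rewrite inE/= in_itv/= => /andP[s0 sl].
  by rewrite /c /concat sl.
apply: eq_Rintegral => s; rewrite inE/= in_itv/= => /andP[s0 sl].
by rewrite /c concatE2// ?lerDr// addrK.
Qed.

(** A unit-speed curve is its own arclength parametrization. *)
Lemma rho_length_unit_speed l c : 0 <= l -> unit_speed 0 l c ->
  rho_length rho 0 l c = (rho_int rho l c)%:E.
Proof.
move=> l0 cu; rewrite /rho_length cu// subr0 /rho_int /Rintegral fineK; last first.
  apply: integrable_fin_num => //.
  exact: integrable_itv_continuous (unit_speed_rho_continuous cu).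
apply: eq_integral => s; rewrite inE/= in_itv/= => /andP[s0 sl].
by rewrite (@arclength_paramE _ _ 0 l c s)// ?s0// cu// subr0.
Qed.

(** The reduction to unit-speed curves: a curve of infinite length has infinite [rho_length], hence
    never competes in the infimum that defines [rho_dist]. *)
Lemma rho_length_arclength x y a b g : curve_joining x y a b g ->
  rho_length rho a b g = +oo%E \/
  exists l c, [/\ 0 <= l, unit_speed 0 l c, c 0 = x, c l = y &
    rho_length rho a b g = (rho_int rho l c)%:E].
Proof.
move=> [ab cg <- <-]; rewrite /rho_length.
case E : (curve_length a b g) => [l| |]; [right|by left|by left].
have [l0 cu c0 cl] := unit_speed_arclength ab cg E.
exists l, (arclength_param a b g); split => //.
rewrite /rho_int /Rintegral fineK//; apply: integrable_fin_num => //.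
exact: integrable_itv_continuous (unit_speed_rho_continuous cu).
Qed.

Let rho_lengths x y := [set l | exists a b g,
    curve_joining x y a b g /\ l = rho_length rho a b g].

Lemma rho_lengths_ge0 x y (l : \bar R) : rho_lengths x y l -> (0 <= l)%E.
Proof.
move=> [a [b [g [j ->]]]]; case: (rho_length_arclength j) => [->//|].
by move=> [l' [c [_ _ _ _ ->]]]; rewrite lee_fin rho_int_ge0.
Qed.

Lemma rho_lengths_int x y l c : 0 <= l -> unit_speed 0 l c -> c 0 = x -> c l = y ->
  rho_lengths x y (rho_int rho l c)%:E.
Proof.
move=> l0 cu c0 cl; exists 0, l, c; split; last by rewrite rho_length_unit_speed.
by split => //; exact: unit_speed_continuous.
Qed.

Hypothesis gX : geodesic_space X.

Lemma geodesic_joining0 x y : exists g, geodesic_joining x y 0 (mdist x y) g.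
Proof.
have [a [b [g [ab gg gx gy]]]] := gX x y.
have xy : mdist x y = b - a.
  by rewrite -gx -gy gg/= ?in_itv/= ?lexx ?andbT// distrC ger0_norm ?subr_ge0.
exists (fun t => g (t + a)); split; rewrite ?mdist_ge0 ?add0r ?xy ?subrK//.
move=> s t; rewrite /= !in_itv/= !lerBrDr => /andP[s0 sl] /andP[t0 tl].
by rewrite gg/= ?in_itv/= ?lerDr ?s0 ?t0//; congr `|_|; lra.
Qed.

(** A geodesic is a competitor of finite length. Finiteness matters because [fine] would send an
    infinite infimum to 0. *)
Lemma rho_inf_fin x y : ereal_inf (rho_lengths x y) \is a fin_num.
Proof.
have [g [xy0 gg g0 gl]] := geodesic_joining0 x y.
have /ereal_inf_lbound h := rho_lengths_int xy0 (geodesic_unit_speed gg) g0 gl.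
rewrite ge0_fin_numE; first exact: le_lt_trans h (ltry _).
by apply: le_ereal_inf_tmp => l; exact: rho_lengths_ge0.
Qed.

Lemma rho_dist_le_int x y l c : 0 <= l -> unit_speed 0 l c -> c 0 = x -> c l = y ->
  rho_dist rho x y <= rho_int rho l c.
Proof.
move=> l0 cu c0 cl; rewrite -lee_fin fineK ?rho_inf_fin//.
exact/ereal_inf_lbound/rho_lengths_int.
Qed.

Lemma rho_dist_adherent x y e : 0 < e -> exists l c,
  [/\ 0 <= l, unit_speed 0 l c, c 0 = x, c l = y &
      rho_int rho l c < rho_dist rho x y + e].
Proof.
move=> e0; have [_ [a [b [g [j ->]]]]] := lb_ereal_inf_adherent e0 (rho_inf_fin x y).
rewrite -(fineK (rho_inf_fin x y)) -EFinD.
case: (rho_length_arclength j) => [->//|[l [c [l0 cu c0 cl ->]]]].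
by rewrite lte_fin => h; exists l, c.
Qed.

Lemma rho_dist_ge0 x y : 0 <= rho_dist rho x y.
Proof.
apply/ler_addgt0Pr => e e0; have [l [c [_ _ _ _ /ltW]]] := rho_dist_adherent x y e0.
exact/le_trans/rho_int_ge0.
Qed.

Lemma rho_dist_xx x : rho_dist rho x x = 0.
Proof.
apply/eqP; rewrite eq_le rho_dist_ge0 andbT.
have [g [xy0 gg g0 gl]] := geodesic_joining0 x x.
apply: le_trans (rho_dist_le_int xy0 (geodesic_unit_speed gg) g0 gl) _.
by rewrite mdistxx /rho_int set_itv1 Rintegral_set1.
Qed.

Lemma rho_dist_sym x y : rho_dist rho x y = rho_dist rho y x.
Proof.
suff H x' y' : rho_dist rho x' y' <= rho_dist rho y' x'.
  by apply/eqP; rewrite eq_le !H.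
apply/ler_addgt0Pr => e e0; have [l [c [l0 cu c0 cl /ltW]]] := rho_dist_adherent y' x' e0.
apply: le_trans; rewrite -rho_int_rev//; apply: rho_dist_le_int => //.
- exact: unit_speed_rev.
- by rewrite oppr0 add0r.
- by rewrite addNr.
Qed.

Lemma rho_dist_triangle x y z :
  rho_dist rho x z <= rho_dist rho x y + rho_dist rho y z.
Proof.
apply/ler_addgt0Pr => e e0; have e20 : 0 < e / 2 by rewrite divr_gt0.
have [l1 [c1 [l10 u1 c10 c1l i1]]] := rho_dist_adherent x y e20.
have [l2 [c2 [l20 u2 c20 c2l i2]]] := rho_dist_adherent y z e20.
have c12 : c1 l1 = c2 0 by rewrite c1l.
apply: (@le_trans _ _ (rho_int rho l1 c1 + rho_int rho l2 c2)); last lra.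
rewrite -(rho_int_concat l10 l20 c12 u1 u2); apply: rho_dist_le_int.
- by rewrite addr_ge0.
- exact: unit_speed_concat.
- by rewrite /concat l10.
- by rewrite concatE2// ?lerDl// addrAC subrr add0r.
Qed.

End Density.
End UnitSpeed.

(** * Limits of sequences and double sequences in epsilon-N form *)

Section NatLimits.
Context {R : realType}.
Implicit Types (u : nat -> R) (f : nat -> nat -> R).

Lemma near_pair_ooP (P : nat -> nat -> Prop) :
  (\forall nm \near (\oo, \oo), P nm.1 nm.2) <->
  exists N, forall n m, (N <= n)%N -> (N <= m)%N -> P n m.
Proof.
split=> [[[A B] [/= [N1 _ AN] [N2 _ BN]] ABP]|[N H]].
  exists (maxn N1 N2) => n m; rewrite !geq_max => /andP[n1 _] /andP[_ m2].
  by apply: (ABP (n, m)); split; [exact: AN|exact: BN].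
exists ([set n | (N <= n)%N], [set n | (N <= n)%N]) => /=.
  by split; exists N.
by move=> [n m] [/= ? ?]; exact: H.
Qed.

Lemma near_ooP (P : nat -> Prop) :
  (\forall n \near \oo, P n) <-> exists N, forall n, (N <= n)%N -> P n.
Proof. by split=> [[N _ H]|[N H]]; exists N. Qed.

Lemma cvg_pair_ltP f (l : R) : f nm.1 nm.2 @[nm --> (\oo, \oo)] --> l <->
  forall e, 0 < e ->
    exists N, forall n m, (N <= n)%N -> (N <= m)%N -> `|l - f n m| < e.
Proof.
split=> [/cvgrPdist_lt H e /H|H].
  exact: (@near_pair_ooP (fun n m => `|l - f n m| < e)).1.
apply/cvgrPdist_lt => e /H.
exact: (@near_pair_ooP (fun n m => `|l - f n m| < e)).2.
Qed.

Lemma cvg_pair_pinftyP f : f nm.1 nm.2 @[nm --> (\oo, \oo)] --> +oo <->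
  forall A, exists N, forall n m, (N <= n)%N -> (N <= m)%N -> A <= f n m.
Proof.
split=> [/cvgryPge H A|H].
  exact: (@near_pair_ooP (fun n m => A <= f n m)).1 (H A).
by apply/cvgryPge => A; apply: (@near_pair_ooP (fun n m => A <= f n m)).2.
Qed.

Lemma cvg_seq_ltP u (l : R) : u n @[n --> \oo] --> l <->
  forall e, 0 < e -> exists N, forall n, (N <= n)%N -> `|l - u n| < e.
Proof.
split=> [/cvgrPdist_lt H e /H /near_ooP//|H].
by apply/cvgrPdist_lt => e /H /near_ooP.
Qed.

Lemma cvg_seq_pinftyP u : u n @[n --> \oo] --> +oo <->
  forall A, exists N, forall n, (N <= n)%N -> A <= u n.
Proof.
split=> [/cvgryPge H A|H].
  exact: (@near_ooP (fun n => A <= u n)).1 (H A).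
by apply/cvgryPge => A; apply: (@near_ooP (fun n => A <= u n)).2.
Qed.

End NatLimits.

(** * Completion of a pseudometric space *)

Section PseudometricCompletion.
Context {R : realType} {X : Type} (d : X -> X -> R).
Implicit Types (u v w : nat -> X) (p q r : set (nat -> X)) (x y : X).
Hypotheses (d_ge0 : forall x y, 0 <= d x y) (dxx : forall x, d x x = 0)
  (d_sym : forall x y, d x y = d y x)
  (d_triangle : forall x y z, d x z <= d x y + d y z).

Lemma d_cauchyP u : d_cauchy d u <-> forall e, 0 < e ->
  exists N, forall n m, (N <= n)%N -> (N <= m)%N -> d (u n) (u m) < e.
Proof.
split=> [/(cvg_pair_ltP (fun n m => d (u n) (u m))) H e /H [N HN]|H].
  by exists N => n m /HN h /h; rewrite sub0r normrN ger0_norm.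
apply/(cvg_pair_ltP (fun n m => d (u n) (u m))) => e /H [N HN].
by exists N => n m /HN h /h; rewrite sub0r normrN ger0_norm.
Qed.

Lemma cvg_dist0_sym u v : d (u n) (v n) @[n --> \oo] --> (0 : R) ->
  d (v n) (u n) @[n --> \oo] --> (0 : R).
Proof. by under eq_fun do rewrite d_sym. Qed.

Lemma cvg_dist0_trans u v w : d (u n) (v n) @[n --> \oo] --> (0 : R) ->
  d (v n) (w n) @[n --> \oo] --> (0 : R) -> d (u n) (w n) @[n --> \oo] --> (0 : R).
Proof.
move=> uv vw.
apply: (@squeeze_cvgr _ _ _ _ (fun=> 0) (fun n => d (u n) (v n) + d (v n) (w n))).
- by apply: nearW => n; rewrite d_ge0 d_triangle.
- exact: cvg_cst.
- by rewrite -[X in _ --> X]addr0; exact: cvgD.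
Qed.

Lemma d_cauchy_refl u : d (u n) (u n) @[n --> \oo] --> (0 : R).
Proof. by under eq_fun do rewrite dxx; exact: cvg_cst. Qed.

Lemma d_cauchy_cst x : d_cauchy d (fun=> x).
Proof. by apply/d_cauchyP => e e0; exists 0%N => n m _ _; rewrite dxx. Qed.

Lemma dist_quadrangle x y x' y' : `|d x y - d x' y'| <= d x x' + d y y'.
Proof.
have := d_triangle x x' y; have := d_triangle x' y' y.
have := d_triangle x' x y'; have := d_triangle x y y'.
rewrite (d_sym x' x) (d_sym y' y) => *; rewrite ler_norml; apply/andP; split; lra.
Qed.

Lemma d_cauchy_dist_cvg u v : d_cauchy d u -> d_cauchy d v ->
  exists l : R, d (u n) (v n) @[n --> \oo] --> l.
Proof.
move=> /d_cauchyP cu /d_cauchyP cv; apply/cvg_ex/cauchy_cvgP/cauchy_exP => e e0.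
have e20 : 0 < e / 2 by rewrite divr_gt0.
have [N1 H1] := cu _ e20; have [N2 H2] := cv _ e20.
pose N := maxn N1 N2; exists (d (u N) (v N)).
apply: (@near_ooP (fun n => ball (d (u N) (v N)) e (d (u n) (v n)))).2.
exists N => n; rewrite geq_max => /andP[n1 n2].
rewrite /ball/=; apply: le_lt_trans (dist_quadrangle _ _ _ _) _.
have := H1 _ _ (leq_maxl N1 N2) n1; have := H2 _ _ (leq_maxr N1 N2) n2; rewrite -/N; lra.
Qed.

Lemma completion_class_self u : d_cauchy d u -> completion_class d u u.
Proof. by move=> cu; split => //; exact: d_cauchy_refl. Qed.

Lemma completion_class_eq u v : d (u n) (v n) @[n --> \oo] --> (0 : R) ->
  completion_class d u = completion_class d v.
Proof.
move=> uv; apply/seteqP; split => w [cw] h; split => //.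
  exact: cvg_dist0_trans (cvg_dist0_sym uv) h.
exact: cvg_dist0_trans uv h.
Qed.

Lemma completionE p u : completion d p -> p u -> d_cauchy d u /\ p = completion_class d u.
Proof. by move=> [v [cv ->]] [cu vu]; split => //; exact: completion_class_eq. Qed.

Lemma completion_ex p : completion d p -> exists u, p u.
Proof. by move=> [u [cu ->]]; exists u; exact: completion_class_self. Qed.

Lemma completion_class_completion u : d_cauchy d u -> completion d (completion_class d u).
Proof. by exists u. Qed.

Lemma completion_embed_completion x : completion d (completion_embed d x).
Proof. exact/completion_class_completion/d_cauchy_cst. Qed.

Lemma completion_embed_self x : completion_embed d x (fun=> x).
Proof. exact/completion_class_self/d_cauchy_cst. Qed.

(** [completion_dist] selects a limit along some representatives; the quadrangle inequality squeezes
    the difference with any other representatives to 0, so the selected value is the limit for all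
    of them. *)
Lemma completion_dist_cvg p q u v : completion d p -> completion d q -> p u -> q v ->
  d (u n) (v n) @[n --> \oo] --> completion_dist d p q.
Proof.
move=> cp cq pu qv; have [cu pE] := completionE cp pu; have [cv qE] := completionE cq qv.
have [l ul] := d_cauchy_dist_cvg cu cv.
rewrite /completion_dist; set P := [set r | _].
have : P (get P) by apply: getPex; exists l; exists u, v.
move: (get P) => l' [u' [v' [pu' qv' ul']]].
have uu' : d (u n) (u' n) @[n --> \oo] --> (0 : R) by move: pu'; rewrite pE => -[].
have vv' : d (v n) (v' n) @[n --> \oo] --> (0 : R) by move: qv'; rewrite qE => -[].
apply: cvg_sub0 ul'; apply: (@squeeze_cvgr _ _ _ _
  (fun n => - (d (u n) (u' n) + d (v n) (v' n))) (fun n => d (u n) (u' n) + d (v n) (v' n))).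
- by apply: nearW => n; rewrite -ler_norml dist_quadrangle.
- by rewrite -oppr0; apply: cvgN; rewrite -[X in _ --> X]addr0; exact: cvgD.
- by rewrite -[X in _ --> X]addr0; exact: cvgD.
Qed.

Lemma completion_distE p q u v (l : R) : completion d p -> completion d q -> p u -> q v ->
  d (u n) (v n) @[n --> \oo] --> l -> completion_dist d p q = l.
Proof.
move=> cp cq pu qv ul; apply: cvg_unique ul => //.
exact: completion_dist_cvg.
Qed.

Lemma completion_dist_ge0 p q : completion d p -> completion d q -> 0 <= completion_dist d p q.
Proof.
move=> cp cq; have [u pu] := completion_ex cp; have [v qv] := completion_ex cq.
have h := completion_dist_cvg cp cq pu qv.
rewrite -(cvg_lim _ h)//; apply: limr_ge; first by apply/cvg_ex; eexists; exact: h.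
by apply: nearW => n.
Qed.

Lemma completion_dist_sym p q : completion d p -> completion d q ->
  completion_dist d p q = completion_dist d q p.
Proof.
move=> cp cq; have [u pu] := completion_ex cp; have [v qv] := completion_ex cq.
apply: (completion_distE cp cq pu qv); under eq_fun do rewrite d_sym.
exact: completion_dist_cvg.
Qed.

Lemma completion_dist_triangle p q r : completion d p -> completion d q -> completion d r ->
  completion_dist d p r <= completion_dist d p q + completion_dist d q r.
Proof.
move=> cp cq cr; have [u pu] := completion_ex cp; have [v qv] := completion_ex cq.
have [w rw] := completion_ex cr.
have h1 := completion_dist_cvg cp cq pu qv; have h2 := completion_dist_cvg cq cr qv rw.
apply: ler_cvg_to (completion_dist_cvg cp cr pu rw) (cvgD h1 h2) _.
by apply: nearW => n; exact: d_triangle.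
Qed.

Lemma completion_distxx p : completion d p -> completion_dist d p p = 0.
Proof.
move=> cp; have [u pu] := completion_ex cp.
exact: (completion_distE cp cp pu pu (d_cauchy_refl _)).
Qed.

Lemma completion_dist_eq0 p q : completion d p -> completion d q ->
  completion_dist d p q = 0 -> p = q.
Proof.
move=> cp cq pq; have [u pu] := completion_ex cp; have [v qv] := completion_ex cq.
have [_ ->] := completionE cp pu; have [_ ->] := completionE cq qv.
by apply: completion_class_eq; rewrite -pq; exact: completion_dist_cvg.
Qed.

Lemma completion_limit_class u : d_cauchy d u -> completion_limit d u (completion_class d u).
Proof.
move=> cu; have cp := completion_class_completion cu; split => //.
apply/cvg_seq_ltP => e e0.
have e20 : 0 < e / 2 by rewrite divr_gt0.
have [N HN] := (d_cauchyP u).1 cu _ e20; exists N => n Nn.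
have ce := completion_embed_completion (u n).
have h := completion_dist_cvg ce cp (completion_embed_self (u n)) (completion_class_self cu).
rewrite sub0r normrN ger0_norm ?completion_dist_ge0//.
apply: (@le_lt_trans _ _ (e / 2)); last lra.
apply: ler_cvg_to h (cvg_cst (e / 2)) _; apply/near_ooP; exists N => m Nm.
by rewrite ltW// HN.
Qed.

Lemma completion_limit_unique u p q :
  completion_limit d u p -> completion_limit d u q -> p = q.
Proof.
move=> [cp up] [cq uq]; apply: completion_dist_eq0 => //.
apply/eqP; rewrite eq_le completion_dist_ge0// andbT.
have h : completion_dist d (completion_embed d (u n)) p +
    completion_dist d (completion_embed d (u n)) q @[n --> \oo] --> (0 : R).
  by rewrite -[X in _ --> X]addr0; exact: cvgD.
apply: ler_cvg_to (cvg_cst (completion_dist d p q)) h _; apply: nearW => n.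
have ce := completion_embed_completion (u n).
by rewrite (completion_dist_sym ce cp); exact: completion_dist_triangle.
Qed.

Section CommonLimit.
Variables (xi : set (nat -> X)) (u : nat -> X).
Hypotheses (xiu : xi u)
  (xi0 : forall v w, xi v -> xi w -> d (v n) (w n) @[n --> \oo] --> (0 : R))
  (xi_cauchy : forall v, xi v -> d_cauchy d v).

Lemma common_limit_class : common_limit d xi (completion_class d u).
Proof.
move=> v xiv; rewrite (completion_class_eq (xi0 xiu xiv)).
exact/completion_limit_class/xi_cauchy.
Qed.

Lemma common_limit_unique : exists! p, common_limit d xi p.
Proof.
exists (completion_class d u); split; first exact: common_limit_class.
by move=> p h; apply: completion_limit_unique (common_limit_class xiu) (h _ xiu).
Qed.

(** The set from which [canonical_map] chooses is a singleton, since limits of [u] are unique. *)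
Lemma canonical_mapE : canonical_map d xi = completion_class d u.
Proof.
have h : common_limit d xi (canonical_map d xi).
  by apply: getPex; exists (completion_class d u); exact: common_limit_class.
exact: completion_limit_unique (h _ xiu) (common_limit_class xiu).
Qed.

End CommonLimit.

End PseudometricCompletion.

(** * Slim triangles, and distance and Busemann functions along geodesics *)

Section Hyperbolic.
Context {R : realType} {X : metricType R}.
Implicit Types (x y z p q w : X) (g : R -> X) (f b : X -> R) (s t : R) (delta : R).

(** The slack [e] replaces attainment of the infimum. The point [q] shows that [E] is nonempty,
    since [inf] of the empty set is 0 by convention. *)
Lemma dist_set_le x (E : set X) q (r e : R) : E q -> dist_set x E <= r -> 0 < e ->
  exists2 q', E q' & mdist x q' <= r + e.
Proof.
move=> Eq xE e0.
have [||_ [q' Eq' <-] h] := @inf_lt _ [set mdist x y | y in E] (r + e).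
- by exists (mdist x q), q.
- by apply: le_lt_trans xE _; rewrite ltrDl.
- by exists q'; rewrite ?ltW.
Qed.

(** Equality in the triangle inequality: the only information kept about a point on a side of a
    triangle. *)
Definition between x q y := mdist x q + mdist q y = mdist x y.

Lemma geodesic_between x y g s : geodesic_joining x y 0 (mdist x y) g ->
  0 <= s <= mdist x y ->
  [/\ mdist x (g s) = s, mdist (g s) y = mdist x y - s & between x (g s) y].
Proof.
move=> [_ gg gx gy] /andP[s0 sl].
have h1 : mdist x (g s) = s.
  rewrite -[X in mdist X _]gx gg /= ?in_itv/= ?lexx ?s0 ?sl ?mdist_ge0//.
  by rewrite distrC subr0 ger0_norm.
have h2 : mdist (g s) y = mdist x y - s.
  rewrite -[X in mdist _ X]gy gg /= ?in_itv/= ?lexx ?s0 ?sl ?mdist_ge0//.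
  by rewrite distrC ger0_norm// subr_ge0.
by split=> //; rewrite /between h1 h2; lra.
Qed.

Lemma geodesic_dist x y g s t : geodesic_joining x y 0 (mdist x y) g ->
  0 <= s <= mdist x y -> 0 <= t <= mdist x y -> mdist (g s) (g t) = `|s - t|.
Proof. by move=> [_ gg _ _] hs ht; rewrite gg//= in_itv. Qed.

Lemma geodesic_edge_between x y (E : set X) q : geodesic_edge x y E -> E q ->
  between x q y.
Proof.
move=> [a [b [g [[ab gg <- <-] ->]]]] [s]; rewrite /= in_itv/= => /andP[as_ sb] <-.
rewrite /between !gg /= ?in_itv/= ?lexx ?as_ ?sb ?ab//.
by rewrite !ler0_norm ?subr_le0//; lra.
Qed.

Hypothesis gX : geodesic_space X.

(** The constant is [delta + 1] because the distance to the two other sides is an infimum, from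
    which a nearby point is extracted with an error 1. *)
Lemma geodesic_slim delta x y z g s : hyperbolic X delta ->
  geodesic_joining x y 0 (mdist x y) g ->
  0 <= s <= mdist x y ->
  exists q, mdist (g s) q <= delta + 1 /\ (between y q z \/ between z q x).
Proof.
move=> hX gg hs.
have e1 : geodesic_edge x y (g @` `[0, mdist x y]) by exists 0, (mdist x y), g.
have [g2 h2] := geodesic_joining0 gX y z; have [g3 h3] := geodesic_joining0 gX z x.
have e2 : geodesic_edge y z (g2 @` `[0, mdist y z]) by exists 0, (mdist y z), g2.
have e3 : geodesic_edge z x (g3 @` `[0, mdist z x]) by exists 0, (mdist z x), g3.
have [H _ _] := hX _ _ _ _ _ _ e1 e2 e3.
have Egs : (g @` `[0, mdist x y]) (g s) by exists s; rewrite //= in_itv.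
have Ey : ((g2 @` `[0, mdist y z]) `|` (g3 @` `[0, mdist z x])) (g2 0).
  by left; exists 0; rewrite //= in_itv/= lexx mdist_ge0.
have [q Eq sq] := dist_set_le Ey (H _ Egs) ltr01; exists q; split => //.
case: Eq => Eq; [left|right]; first exact: geodesic_edge_between e2 _.
exact: geodesic_edge_between e3 _.
Qed.

(* Take the supremum of the parameters whose points are close to [z, x]: later
   points are close to [y, z]. *)
Lemma geodesic_center delta x y z g : 0 <= delta -> hyperbolic X delta ->
  geodesic_joining x y 0 (mdist x y) g ->
  exists s, [/\ 0 <= s <= mdist x y,
    exists2 q, mdist (g s) q <= delta + 2 & between z q x &
    exists2 q, mdist (g s) q <= delta + 2 & between y q z].
Proof.
move=> delta0 hX gg; have l0 := mdist_ge0 x y; have [_ _ gx gy] := gg.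
pose A : set R := [set s | 0 <= s <= mdist x y /\
  exists2 q, mdist (g s) q <= delta + 1 & between z q x].
have A0 : A 0.
  split; first by rewrite lexx.
  exists x; first by rewrite gx mdistxx; lra.
  by rewrite /between mdistxx addr0.
have Aub : has_sup A.
  by split; [exists 0|exists (mdist x y) => s [/andP[]]].
have s0 : 0 <= sup A by apply: ub_le_sup => //; case: Aub.
have sl : sup A <= mdist x y by apply: ge_sup; [exists 0|move=> s [/andP[]]].
have hs : 0 <= sup A <= mdist x y by rewrite s0 sl.
exists (sup A); split => //.
- have [s As hs1] := sup_adherent ltr01 Aub.
  have sA : s <= sup A by apply: ub_le_sup => //; case: Aub.
  have [hs2 [q gq bq]] := As; exists q => //.
  have := metric_triangle (g (sup A)) (g s) q.
  rewrite (geodesic_dist gg)// ger0_norm ?subr_ge0//; lra.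
- move: (sl); rewrite le_eqVlt => /predU1P[->|sl'].
    exists y; first by rewrite gy mdistxx; lra.
    by rewrite /between mdistxx add0r.
  (* A parameter beyond the supremum by at most 1: it is not in [A], so its neighbour given by
     slimness lies between [y] and [z]. *)
  pose t := Num.min (sup A + 1) (mdist x y).
  have st : sup A < t by rewrite lt_min sl' andbT; lra.
  have ts1 : t <= sup A + 1 by rewrite ge_min lexx.
  have ht : 0 <= t <= mdist x y by rewrite (le_trans s0 (ltW st))/= ge_min lexx orbT.
  have [q [gq bq]] := geodesic_slim z hX gg ht; case: bq => bq; last first.
    have : A t by split => //; exists q.
    by move=> At; have := ub_le_sup (proj2 Aub) At; rewrite leNgt st.
  exists q => //; have := metric_triangle (g (sup A)) (g t) q.
  rewrite (geodesic_dist gg)// distrC ger0_norm ?subr_ge0 ?(ltW st)//; lra.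
Qed.

(* With s0 = f x - (x|y)_f, every 1-Lipschitz f satisfies the opposite inequality
   (x|y)_f + |s - s0| <= f (g s), see [lipschitz_lower]. *)
Definition horolike (C : R) f :=
  (forall x y, f x <= f y + mdist x y) /\
  forall x y g s, geodesic_joining x y 0 (mdist x y) g -> 0 <= s <= mdist x y ->
    f (g s) <= gromov_product_at f x y + `|s - (f x - gromov_product_at f x y)| + C.

(** Comparison with the two endpoints gives the lower bounds f x - s and f y - (|xy| - s), whose
    maximum is the left-hand side. *)
Lemma lipschitz_lower f x y g s : (forall x y, f x <= f y + mdist x y) ->
  geodesic_joining x y 0 (mdist x y) g -> 0 <= s <= mdist x y ->
  gromov_product_at f x y + `|s - (f x - gromov_product_at f x y)| <= f (g s).
Proof.
move=> fL gg hs; have [h1 h2 _] := geodesic_between gg hs.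
have f1 := fL x (g s); have f2 := fL y (g s); rewrite metric_sym h2 in f2.
rewrite h1 in f1; rewrite /gromov_product_at.
rewrite -lerBrDl ler_norml; apply/andP; split; lra.
Qed.

(** At the centre [g t] the distance to [p] exceeds the product [m] by at most 2 (delta + 2). By
    [lipschitz_lower] this also bounds |t - s0|, and moving from [t] to [s] at Lipschitz rate 1
    costs |s - s0| + |t - s0|. *)
Lemma horolike_dist delta p : 0 <= delta -> hyperbolic X delta ->
  horolike (4 * (delta + 2)) (fun x => mdist x p).
Proof.
move=> delta0 hX; have fL x y : mdist x p <= mdist y p + mdist x y.
  by rewrite addrC metric_triangle.
split => // x y g s gg hs.
have [t [ht [q1 gq1 bq1] [q2 gq2 bq2]]] := geodesic_center p delta0 hX gg.
have [h1 h2 _] := geodesic_between gg ht.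
have low := lipschitz_lower fL gg ht.
rewrite /gromov_product_at in low *.
set m := (_ + _ - _) / 2 in low *.
(* Through [q1] the distance is at most |xp| - t + 2 (delta + 2), through [q2] at most |yp| - (|xy|
   - t) + 2 (delta + 2); the mean of the two bounds is the claim. *)
have gm : mdist (g t) p <= m + 2 * (delta + 2).
  have := metric_triangle (g t) q1 p; have := metric_triangle (g t) q1 x.
  have := metric_triangle (g t) q2 p; have := metric_triangle (g t) q2 y.
  move: bq1 bq2; rewrite /between !(metric_sym p) !(metric_sym y).
  rewrite (metric_sym q1 x) (metric_sym (g t) x) h1 (metric_sym q2 y) h2.
  rewrite /m (metric_sym q2 p) (metric_sym q1 p) (metric_sym y p) => *; lra.
have := fL (g s) (g t); rewrite (geodesic_dist gg)//.
have := ler_distD (mdist x p - m) s t.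
rewrite [`|_ - m - t|]distrC; lra.
Qed.

Lemma horolikeD C f (r : R) : horolike C f -> horolike C (fun x => f x + r).
Proof.
move=> [fL H]; split; first by move=> x y; have := fL x y; lra.
move=> x y g s gg hs; have := H _ _ _ _ gg hs; rewrite /gromov_product_at.
set m := (f x + f y - mdist x y) / 2.
have -> : (f x + r + (f y + r) - mdist x y) / 2 = m + r by rewrite /m; lra.
have -> : f x + r - (m + r) = f x - m by lra.
lra.
Qed.

(** Both conditions involve the function at no more than three points at a time, so they pass to
    pointwise limits with the same constant. *)
Lemma horolike_limit C f (F : R -> X -> R) : (forall t, horolike C (F t)) ->
  (forall x e, 0 < e -> exists T, forall t, T <= t -> `|F t x - f x| <= e) ->
  horolike C f.
Proof.
move=> FH Ff; split.
  move=> x y; apply/ler_addgt0Pr => e e0; have e20 : 0 < e / 2 by rewrite divr_gt0.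
  have [T1 H1] := Ff x _ e20; have [T2 H2] := Ff y _ e20.
  pose t := Num.max T1 T2.
  have := H1 t; have := H2 t; rewrite !le_max !lexx orbT !ler_norml.
  move=> /(_ isT)/andP[? ?] /(_ isT)/andP[? ?].
  have := (FH t).1 x y; lra.
move=> x y g s gg hs; apply/ler_addgt0Pr => e e0; have e20 : 0 < e / 4 by rewrite divr_gt0.
have [T1 H1] := Ff x _ e20; have [T2 H2] := Ff y _ e20; have [T3 H3] := Ff (g s) _ e20.
pose t := Num.max T1 (Num.max T2 T3).
have := H1 t; have := H2 t; have := H3 t; rewrite !le_max !lexx !orbT !ler_norml.
move=> /(_ isT)/andP[? ?] /(_ isT)/andP[? ?] /(_ isT)/andP[? ?].
have := (FH t).2 _ _ _ _ gg hs; rewrite /gromov_product_at.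
set m := (f x + f y - mdist x y) / 2; set mt := (F t x + F t y - mdist x y) / 2.
have mm : `|(f x - m) - (F t x - mt)| <= e / 4.
  by rewrite /m /mt ler_norml; apply/andP; split; lra.
have := ler_distD (f x - m) s (F t x - mt).
have : mt <= m + e / 4 by rewrite /m /mt; lra.
lra.
Qed.

(** At the parameter f x - m the function is at most m + C. A point within delta + 1 lies on a side
    through [z], and on any geodesic a 1-Lipschitz function is at least the product of the
    endpoints. *)
Lemma horolike_hyperbolic delta C f x y z : hyperbolic X delta -> horolike C f ->
  Num.min (gromov_product_at f x z) (gromov_product_at f z y) - (C + delta + 1)
    <= gromov_product_at f x y.
Proof.
move=> hX [fL H]; have [g gg] := geodesic_joining0 gX x y.
set m := gromov_product_at f x y.
have hs : 0 <= f x - m <= mdist x y.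
  rewrite /m /gromov_product_at; have := fL x y; have := fL y x.
  by rewrite (metric_sym y x) => *; apply/andP; split; lra.
have := H _ _ _ _ gg hs; rewrite -/m subrr normr0 addr0.
have [q [gq bq]] := geodesic_slim z hX gg hs.
have := fL q (g (f x - m)); rewrite (metric_sym q).
have qb u v : between u q v -> gromov_product_at f u v <= f q.
  rewrite /between /gromov_product_at => uv.
  have := fL u q; have := fL v q; rewrite (metric_sym v q); lra.
case: bq => /qb.
- move=> h1 h2 h3; rewrite lerBlDr ge_min; apply/orP; right.
  by move: h1; rewrite /gromov_product_at (metric_sym y z); lra.
- move=> h1 h2 h3; rewrite lerBlDr ge_min; apply/orP; left.
  by move: h1; rewrite /gromov_product_at (metric_sym z x); lra.
Qed.

Lemma ray_dist g s t : geodesic_ray g -> 0 <= s -> s <= t -> mdist (g s) (g t) = t - s.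
Proof.
move=> gg s0 st; rewrite gg /= ?in_itv/= ?andbT//; last exact: le_trans st.
by rewrite distrC ger0_norm// subr_ge0.
Qed.

(** By the triangle inequality |g(t) x| - t is nonincreasing in t and at least -|g(0) x|. Its limit
    is therefore its infimum and is approached from above. *)
Lemma busemann_approx g x : geodesic_ray g -> forall e, 0 < e ->
  exists2 T, 0 <= T & forall t, T <= t ->
    busemann g x <= mdist (g t) x - t <= busemann g x + e.
Proof.
move=> gg; pose h t := mdist (g t) x - t.
have hm s t : 0 <= s -> s <= t -> h t <= h s.
  move=> s0 st; have := metric_triangle (g t) (g s) x.
  by rewrite (metric_sym (g t) (g s)) (ray_dist gg s0 st) /h; lra.
pose A : set R := [set h t | t in [set t | 0 <= t]].
have Alb : has_inf A.
  split; first by exists (h 0), 0 => /=.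
  exists (- mdist (g 0) x) => _ [t t0 <-]; rewrite /h.
  have := metric_triangle (g 0) x (g t); rewrite (ray_dist gg)// (metric_sym x); lra.
have hA t : 0 <= t -> inf A <= h t by move=> t0; apply: (ge_inf (proj2 Alb)); exists t.
have apx e : 0 < e -> exists2 T, 0 <= T & forall t, T <= t -> inf A <= h t <= inf A + e.
  move=> e0; have [_ [T T0 <-] hT] := inf_adherent e0 Alb; exists T => // t Tt.
  by rewrite hA ?(le_trans T0 Tt)// (le_trans (hm _ _ T0 Tt))// ltW.
suff -> : busemann g x = inf A by [].
apply/cvg_lim => //; apply/cvgrPdist_le => e e0.
have [T T0 HT] := apx e e0; near=> t.
have /HT /andP[h1 h2] : T <= t by near: t; apply: nbhs_pinfty_ge; exact: num_real.
by rewrite distrC -/(h t) ger0_norm ?subr_ge0// lerBlDl.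
Unshelve. all: by end_near. Qed.

(** A Busemann function is the pointwise limit of the functions |x g(t)| - t, which are horolike
    with a constant independent of t. *)
Lemma horolike_hatB delta b (w : basepoint X) : 0 <= delta -> hyperbolic X delta ->
  hatB_based b w -> horolike (4 * (delta + 2)) b.
Proof.
move=> delta0 hX; case: w => [z|xi] /=.
  move=> [s bE]; rewrite (_ : b = fun x => mdist x z + s); last exact/funext.
  exact/horolikeD/horolike_dist.
move=> [g [s [gg _ bE]]]; rewrite (_ : b = fun x => busemann g x + s); last exact/funext.
apply: horolikeD; apply: (@horolike_limit _ _ (fun t x => mdist x (g t) + - t)).
  by move=> t; apply: horolikeD; exact: horolike_dist.
move=> x e e0; have [T _ HT] := busemann_approx x gg e0; exists T => t /HT /andP[h1 h2].
by rewrite (metric_sym x) ger0_norm; lra.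
Qed.

End Hyperbolic.

(** * An exponential integral, bounded uniformly in the length of the interval *)

Section ExponentialIntegral.
Context {R : realType}.

Lemma expRN_line_continuous (e m : R) (A : set R) :
  {within A, continuous (fun s => expR (- e * (m + s)))}.
Proof.
apply: continuous_subspaceT => s; apply: continuous_comp; last exact: continuous_expR.
by apply: cvgM; [exact: cvg_cst|apply: cvgD => //; exact: cvg_cst].
Qed.

Lemma Rintegral_expRN_le (e m l : R) : 0 < e -> 0 <= l ->
  \int[lebesgue_measure]_(s in `[0, l]) expR (- e * (m + s)) <= e^-1 * expR (- e * m).
Proof.
move=> e0; rewrite le_eqVlt => /predU1P[<-|l0].
  by rewrite set_itv1 Rintegral_set1 mulr_ge0 ?expR_ge0// invr_ge0 ltW.
pose F s := - e^-1 * expR (- e * (m + s)).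
have dF (s : R) : is_derive s (1 : R) F (expR (- e * (m + s))).
  apply: is_derive_eq; rewrite /GRing.scale/= add0r; field.
  by rewrite gt_eqF.
rewrite /Rintegral (@continuous_FTC2 _ _ F)//.
- rewrite /F addr0 /= !mulNr opprK addrC gerBl.
  by rewrite mulr_ge0 ?expR_ge0// invr_ge0 ltW.
- exact: expRN_line_continuous.
- have cF : continuous F.
    by move=> s; apply: differentiable_continuous; apply/derivable1_diffP; exact: ex_derive.
  split.
  + by move=> s _; exact: ex_derive.
  + by apply: cvg_at_right_filter; exact: cF.
  + by apply: cvg_at_left_filter; exact: cF.
- by move=> s _; rewrite derive1E; apply: derive_val.
Qed.

End ExponentialIntegral.

(** * Upper and lower estimates of the deformed distance *)

Section ConformalBounds.
Context {R : realType} {X : metricType R}.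
Implicit Types (x y z : X) (g : R -> X) (b : X -> R) (eps M C : R).
Hypothesis gX : geodesic_space X.

Lemma rho_eps_gt0 eps b x : 0 < rho_eps eps b x.
Proof. exact: expR_gt0. Qed.

Lemma rho_dist_geodesic_le (rho : X -> R) (h : R -> R) x y g :
  continuous rho -> (forall x, 0 < rho x) ->
  geodesic_joining x y 0 (mdist x y) g ->
  {within `[0, mdist x y], continuous h} ->
  (forall s, 0 <= s <= mdist x y -> rho (g s) <= h s) ->
  rho_dist rho x y <= \int[lebesgue_measure]_(s in `[0, mdist x y]) h s.
Proof.
move=> crho rho0 gg ch gh; have [l0 gg' gx gy] := gg.
have ug := geodesic_unit_speed gg'.
apply: le_trans (rho_dist_le_int crho rho0 gX l0 ug gx gy) _.
apply: le_Rintegral => //.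
- exact: integrable_itv_continuous (unit_speed_rho_continuous crho ug).
- exact: integrable_itv_continuous.
Qed.

(** The point at distance s from [x] is at distance |xy| - s from [y], so [b] is there at least b y
    - |xy| + s, and the exponential integral applies. *)
Lemma rho_dist_le_exp eps b x y : 0 < eps -> continuous (rho_eps eps b) ->
  (forall x y, b x <= b y + mdist x y) ->
  rho_dist (rho_eps eps b) x y <= eps^-1 * expR (- eps * (b y - mdist x y)).
Proof.
move=> eps0 crho bL; have [g gg] := geodesic_joining0 gX x y.
apply: le_trans (Rintegral_expRN_le _ eps0 (mdist_ge0 x y)).
apply: (rho_dist_geodesic_le crho (rho_eps_gt0 eps b) gg).
  exact: expRN_line_continuous.
move=> s hs; rewrite ler_expR !mulNr lerN2 ler_pM2l//.
have [_ h2 _] := geodesic_between gg hs; have := bL y (g s); rewrite metric_sym h2; lra.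
Qed.

(** Cut the geodesic at s0 = b x - m. For each half, read from the cut point, the previous bound
    starts at the height [m]; this accounts for the factor 2. *)
Lemma rho_dist_le_gromov eps b x y : 0 < eps -> continuous (rho_eps eps b) ->
  (forall x y, b x <= b y + mdist x y) ->
  rho_dist (rho_eps eps b) x y <=
    2 * eps^-1 * expR (- eps * gromov_product_at b x y).
Proof.
move=> eps0 crho bL; have [g gg] := geodesic_joining0 gX x y.
set m := gromov_product_at b x y; set rho := rho_eps eps b.
have hs : 0 <= b x - m <= mdist x y.
  rewrite /m /gromov_product_at; have := bL x y; have := bL y x.
  by rewrite (metric_sym y x) => *; apply/andP; split; lra.
have [h1 h2 _] := geodesic_between gg hs.
apply: le_trans (rho_dist_triangle crho (rho_eps_gt0 eps b) gX x (g (b x - m)) y) _.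
rewrite (rho_dist_sym crho (rho_eps_gt0 eps b) gX x).
have := rho_dist_le_exp (g (b x - m)) x eps0 crho bL.
have := rho_dist_le_exp (g (b x - m)) y eps0 crho bL.
rewrite h2 (metric_sym _ x) h1.
have -> : b y - (mdist x y - (b x - m)) = m by rewrite /m /gromov_product_at; lra.
have -> : b x - (b x - m) = m by lra.
by rewrite -mulrA mulr_natl mulr2n -/rho => *; exact: lerD.
Qed.

(** A local bound, used to see that convergence in [X] implies convergence for the deformed
    distance. *)
Lemma rho_dist_le_mdist eps b x y : 0 < eps -> continuous (rho_eps eps b) ->
  (forall x y, b x <= b y + mdist x y) ->
  rho_dist (rho_eps eps b) x y <= expR (- eps * (b x - mdist x y)) * mdist x y.
Proof.
move=> eps0 crho bL; have [g gg] := geodesic_joining0 gX x y.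
pose h := cst (expR (- eps * (b x - mdist x y))) : R -> R.
apply: le_trans (rho_dist_geodesic_le (h := h) crho (rho_eps_gt0 eps b) gg _ _) _.
- by apply: continuous_subspaceT => s; exact: cvg_cst.
- move=> s hs; rewrite ler_expR !mulNr lerN2 ler_pM2l//.
  have [h1 _ _] := geodesic_between gg hs; have := bL x (g s); rewrite h1.
  by case/andP : hs => _ ? ?; lra.
- rewrite Rintegral_cst//= lebesgue_measure_itv/= lte_fin.
  by case: ifPn => [_|_] /=; rewrite ?subr0 ?mulr0 ?mulr_ge0 ?expR_ge0 ?mdist_ge0.
Qed.

(* Integrate only over an interval of length min(1, |xy|) containing s0. *)
Lemma rho_dist_ge_gromov eps b x y M C : 0 < eps -> GH_density (rho_eps eps b) M ->
  horolike C b ->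
  expR (- eps * (gromov_product_at b x y + C + 1)) * Num.min 1 (mdist x y) <=
    M * rho_dist (rho_eps eps b) x y.
Proof.
move=> eps0 [[crho rho0] GH] [bL bC]; have [g gg] := geodesic_joining0 gX x y.
set m := gromov_product_at b x y; set rho := rho_eps eps b.
have [l0 gg' gx gy] := gg; have ug := geodesic_unit_speed gg'.
have := GH _ _ _ _ _ gg; rewrite (rho_length_unit_speed crho l0 ug) lee_fin.
apply: le_trans; rewrite /rho_int; set l := mdist x y in l0 ug *.
have hs : 0 <= b x - m <= l.
  rewrite /m /gromov_product_at /l; have := bL x y; have := bL y x.
  by rewrite (metric_sym y x) => *; apply/andP; split; lra.
(* The window [a, a + r] starts at [s0], or ends at [l] when [s0] is too close to [l]. In both cases
   it contains [s0] and |s - s0| <= 1 on it, which is the 1 in the exponent. *)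
set s0 := b x - m in hs; pose r := Num.min 1 l; pose a := Num.min s0 (l - r).
have r0 : 0 <= r by rewrite le_min ler01.
have r1 : r <= 1 by rewrite ge_min lexx.
have rl : r <= l by rewrite ge_min lexx orbT.
have /andP[hs1 hs2] := hs.
have a0 : 0 <= a by rewrite le_min hs1 [0 <= l - r]subr_ge0.
have as0 : a <= s0 by rewrite ge_min lexx.
have al : a <= l - r by rewrite ge_min lexx orbT.
have s0a : s0 <= a + r by rewrite -lerBlDr le_min; apply/andP; split; lra.
have ci := integrable_itv_continuous (unit_speed_rho_continuous crho ug).
have sub : `[a, (a + r)%R]%classic `<=` `[0, l]%classic.
  by apply: subset_itv; rewrite bnd_simp//; lra.
rewrite /Rintegral.
apply: (@le_trans _ _ (\int[lebesgue_measure]_(s in `[a, (a + r)%R]) rho (g s))%R);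
  last first.
  rewrite /Rintegral; apply: fine_le.
  - by apply: integrable_fin_num => //; exact: integrableS ci.
  - exact: integrable_fin_num.
  - apply: ge0_subset_integral => //; first by case/integrableP: ci.
    by move=> s _; rewrite lee_fin ltW.
have mr : fine (lebesgue_measure (`[a, (a + r)%R]%classic : set R)) = r.
  rewrite lebesgue_measure_itv/= lte_fin ltrDl; case: ltP => [_|r0'] /=.
    by rewrite addrAC subrr add0r.
  by apply/eqP; rewrite eq_le r0 r0'.
rewrite -/r -[X in _ * X <= _]mr.
rewrite -Rintegral_cst//; apply: le_Rintegral => //.
- by apply: integrable_itv_continuous; apply: continuous_subspaceT => s; exact: cvg_cst.
- exact: integrableS ci.
- move=> s; rewrite /= in_itv/= => /andP[as_ sa].
  have sl : 0 <= s <= l by rewrite (le_trans a0 as_) (le_trans sa)//; lra.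
  rewrite ler_expR !mulNr lerN2 ler_pM2l//.
  apply: le_trans (bC _ _ _ _ gg sl) _; rewrite -/m -/s0.
  by have : `|s - s0| <= 1 by [rewrite ler_norml; apply/andP; split; lra]; lra.
Qed.

End ConformalBounds.

(** * Sequences converging to infinity and their Gromov products based at [b] *)

Section GromovSequences.
Context {R : realType} {X : metricType R}.
Implicit Types (x y z p : X) (u v : nat -> X) (xi zeta : set (nat -> X)) (g : R -> X).
Hypothesis gX : geodesic_space X.
Hypothesis hypX : exists2 delta : R, 0 <= delta & hyperbolic X delta.

(** The four-point inequality: [gromov_product p] is [gromov_product_at] of the distance to [p],
    which is horolike. *)
Lemma gromov_product_ultra p : exists2 c : R, 0 <= c & forall x y z,
  Num.min (gromov_product p x z) (gromov_product p z y) - c <= gromov_product p x y.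
Proof.
have [delta d0 hX] := hypX; exists (4 * (delta + 2) + delta + 1); first lra.
by move=> x y z; exact: (horolike_hyperbolic gX x y z hX (horolike_dist gX p d0 hX)).
Qed.

Lemma gromov_product_basepoint p q x y :
  gromov_product p x y <= gromov_product q x y + mdist p q.
Proof.
rewrite /gromov_product; have := metric_triangle x q p; have := metric_triangle y q p.
rewrite (metric_sym q p); lra.
Qed.

Lemma gromov_product_xx p x : gromov_product p x x = mdist x p.
Proof. by rewrite /gromov_product mdistxx; lra. Qed.

Lemma gromov_product_sym p x y : gromov_product p x y = gromov_product p y x.
Proof. by rewrite /gromov_product (metric_sym x y) [mdist y p + _]addrC. Qed.

Lemma converges_to_infinityP p u : converges_to_infinity u <->
  forall A : R, exists N, forall n m, (N <= n)%N -> (N <= m)%N ->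
    A <= gromov_product p (u n) (u m).
Proof.
split=> [/(_ p)/(cvg_pair_pinftyP (fun n m => gromov_product p (u n) (u m)))//|H q].
apply/(cvg_pair_pinftyP (fun n m => gromov_product q (u n) (u m))) => A.
have [N HN] := H (A + mdist p q); exists N => n m nN mN.
by have := HN n m nN mN; have := gromov_product_basepoint p q (u n) (u m); lra.
Qed.

Lemma boundary_equivP p u v : boundary_equiv u v <->
  forall A : R, exists N, forall n, (N <= n)%N -> A <= gromov_product p (u n) (v n).
Proof.
split=> [/(_ p)/cvg_seq_pinftyP//|H q]; apply/cvg_seq_pinftyP => A.
have [N HN] := H (A + mdist p q); exists N => n nN.
by have := HN n nN; have := gromov_product_basepoint p q (u n) (v n); lra.
Qed.

(** One far pair [u k], [v m] with a large product is enough: the four-point inequality through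
    [u k] and then [v m] carries the bound to all later pairs, at a cost [c] each time. The
    contrapositive bounds the products of inequivalent sequences. *)
Lemma boundary_equiv_cofinal p u v :
  converges_to_infinity u -> converges_to_infinity v ->
  (forall (A : R) N, exists k m, [/\ (N <= k)%N, (N <= m)%N &
    A <= gromov_product p (u k) (v m)]) ->
  boundary_equiv u v.
Proof.
move=> /(converges_to_infinityP p) cu /(converges_to_infinityP p) cv H.
apply/(boundary_equivP p) => A.
have [c c0 Hc] := gromov_product_ultra p.
have [N1 H1] := cu (A + 2 * c); have [N2 H2] := cv (A + 2 * c).
have [k [m []]] := H (A + 2 * c) (maxn N1 N2).
rewrite !geq_max => /andP[k1 k2] /andP[m1 m2] km.
exists (maxn N1 N2) => n; rewrite geq_max => /andP[n1 n2].
have h1 := Hc (u n) (v n) (u k); have h2 := Hc (u k) (v n) (v m).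
apply: le_trans h1; rewrite lerBrDr le_min; apply/andP; split.
  by have := H1 n k n1 k1; lra.
suff : A + 2 * c - c <= gromov_product p (u k) (v n) by lra.
apply: le_trans h2; rewrite lerD2r le_min km /=.
exact: H2.
Qed.

Lemma boundary_equiv_cross p u v : converges_to_infinity u -> boundary_equiv u v ->
  forall A : R, exists N, forall n m, (N <= n)%N -> (N <= m)%N ->
    A <= gromov_product p (u n) (v m).
Proof.
move=> /(converges_to_infinityP p) cu /(boundary_equivP p) uv A.
have [c c0 Hc] := gromov_product_ultra p.
have [N1 H1] := cu (A + c); have [N2 H2] := uv (A + c).
exists (maxn N1 N2) => n m; rewrite !geq_max => /andP[n1 n2] /andP[m1 m2].
apply: le_trans (Hc _ _ (u m)); rewrite lerBrDr le_min H1//=.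
exact: H2.
Qed.

Lemma boundary_equiv_refl u : converges_to_infinity u -> boundary_equiv u u.
Proof.
move=> cu; apply/(boundary_equivP (u 0%N)) => A.
by have [N HN] := (converges_to_infinityP (u 0%N) u).1 cu A; exists N => n nN; exact: HN.
Qed.

Lemma boundary_equiv_sym u v : boundary_equiv u v -> boundary_equiv v u.
Proof. by move=> uv p; under eq_fun do rewrite gromov_product_sym; exact: uv. Qed.

Lemma boundary_equiv_trans u v w : boundary_equiv u v -> boundary_equiv v w ->
  boundary_equiv u w.
Proof.
move=> uv vw; pose p := u 0%N; apply/(boundary_equivP p) => A.
have [c c0 Hc] := gromov_product_ultra p.
have [N1 H1] := (boundary_equivP p u v).1 uv (A + c).
have [N2 H2] := (boundary_equivP p v w).1 vw (A + c).
exists (maxn N1 N2) => n; rewrite geq_max => /andP[n1 n2].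
apply: le_trans (Hc _ _ (v n)); rewrite lerBrDr le_min H1//=.
exact: H2.
Qed.

Lemma boundary_class_eq u v : boundary_equiv u v -> boundary_class u = boundary_class v.
Proof.
move=> uv; apply/seteqP; split => w [cw h]; split => //.
  exact: boundary_equiv_trans (boundary_equiv_sym uv) h.
exact: boundary_equiv_trans uv h.
Qed.

Lemma gromov_boundaryE xi u : gromov_boundary X xi -> xi u ->
  converges_to_infinity u /\ xi = boundary_class u.
Proof. by move=> [v [cv ->]] [cu vu]; split => //; exact: boundary_class_eq. Qed.

Lemma gromov_boundary_ex xi : gromov_boundary X xi -> exists u, xi u.
Proof. by move=> [u [cu ->]]; exists u; split => //; exact: boundary_equiv_refl. Qed.

Lemma gromov_boundary_equiv xi u v : gromov_boundary X xi -> xi u -> xi v ->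
  boundary_equiv u v.
Proof. by move=> xiB xiu xiv; move: xiv; rewrite (gromov_boundaryE xiB xiu).2 => -[]. Qed.

Lemma converges_to_infinity_far p u : converges_to_infinity u ->
  forall A : R, exists N, forall n, (N <= n)%N -> A <= mdist (u n) p.
Proof.
move=> /(converges_to_infinityP p) cu A; have [N HN] := cu A; exists N => n nN.
by rewrite -gromov_product_xx HN.
Qed.

Lemma not_boundary_equiv p u v : converges_to_infinity u -> converges_to_infinity v ->
  ~ boundary_equiv u v -> exists (A : R) N, forall n, (N <= n)%N ->
    1 <= mdist (u n) (v n) /\ gromov_product p (u n) (v n) <= A.
Proof.
move=> cu cv uv; have [A [N0 H]] : exists (A : R) N, forall n, (N <= n)%N ->
    gromov_product p (u n) (v n) <= A.
  apply: contrapT => nH; apply: uv; apply: (boundary_equiv_cofinal (p := p)) => // A N.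
  apply: contrapT => nk; apply: nH; exists A, N => n nN.
  by rewrite leNgt; apply/negP => /ltW h; apply: nk; exists n, n.
(* Two points at distance at least A + 1 from [p] with product at most A are at distance at least 2
   from each other. *)
have [N1 H1] := converges_to_infinity_far p cu (A + 1).
have [N2 H2] := converges_to_infinity_far p cv (A + 1).
exists A, (maxn N0 (maxn N1 N2)) => n; rewrite !geq_max => /and3P[n0 n1 n2].
split; last exact: H.
have := H n n0; have := H1 n n1; have := H2 n n2; rewrite /gromov_product; lra.
Qed.

Lemma nat_ge (r : R) : exists n : nat, r <= n%:R.
Proof.
exists (Num.bound `|r|); apply: le_trans (ler_norm r) _.
by rewrite ltW// archi_boundP.
Qed.

(** Based at [g 0], the product of the points at times n and m is the smaller of n and m. *)
Lemma converges_to_infinity_ray g : geodesic_ray g -> converges_to_infinity (pos_seq g).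
Proof.
move=> gg; apply/(converges_to_infinityP (g 0)) => A.
have [N HN] := nat_ge A; exists N => n m nN mN.
have g0 (k : nat) : mdist (pos_seq g k) (g 0) = k%:R.
  by rewrite metric_sym /pos_seq (ray_dist gg)// subr0.
rewrite /gromov_product !g0.
wlog nm : n m nN mN / (n <= m)%N.
  move=> W; have [nm|/ltnW mn] := leqP n m; first exact: W.
  by rewrite [n%:R + _]addrC metric_sym; exact: W.
rewrite /pos_seq (ray_dist gg) ?ler_nat//.
have : N%:R <= n%:R :> R by rewrite ler_nat.
lra.
Qed.

Variables (b : X -> R) (w : basepoint X).
Hypothesis bw : hatB_based b w.

Lemma hatB_lipschitz x y : b x <= b y + mdist x y.
Proof.
by have [delta d0 hX] := hypX; have [bL _] := horolike_hatB gX d0 hX bw; exact: bL.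
Qed.

Lemma gromov_product_at_le p x y :
  gromov_product_at b x y <= gromov_product p x y + b p.
Proof.
rewrite /gromov_product_at /gromov_product.
have := hatB_lipschitz x p; have := hatB_lipschitz y p; lra.
Qed.

Lemma gromov_product_at_lel x y : gromov_product_at b x y <= b x.
Proof.
rewrite /gromov_product_at; have := hatB_lipschitz y x; rewrite (metric_sym y); lra.
Qed.

Lemma boundary_minus_boundary xi : boundary_minus w xi -> gromov_boundary X xi.
Proof. by case: w => [z//|omega] []. Qed.

(** If [b] is a distance function, its products are ordinary ones up to a constant. If the basepoint
    is at infinity, |x g(0)| - b x stays bounded above along sequences that represent [xi], so
    passing from the base point [g 0] to [b] loses a bounded amount. *)
Lemma hatB_boundary_pinfty xi u v : boundary_minus w xi -> xi u -> xi v ->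
  forall A : R, exists N, forall n m, (N <= n)%N -> (N <= m)%N ->
    A <= gromov_product_at b (u n) (v m).
Proof.
move=> wxi xiu xiv; have xiB := boundary_minus_boundary wxi.
have [cu xiE] := gromov_boundaryE xiB xiu; have [cv xiE'] := gromov_boundaryE xiB xiv.
have uv := gromov_boundary_equiv xiB xiu xiv.
move: bw wxi; case: w => [z|omega] /=.
  move=> [s bE] _ A; have [N HN] := boundary_equiv_cross z cu uv (A - s).
  exists N => n m nN mN; have := HN n m nN mN.
  by rewrite /gromov_product /gromov_product_at !bE; lra.
move=> [g [s [gg omegaE bE]]] [_ xiomega].
(* mdist (u' n) (g 0) - b (u' n) + s is twice the limit of (u' n|g t) based at
   g 0 as t -> oo; if it were unbounded, u' would represent omega. *)
have key u' : xi u' -> exists (B : R) N, forall n, (N <= n)%N ->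
    mdist (u' n) (g 0) - b (u' n) <= B.
  move=> xiu'; have [cu' xiE''] := gromov_boundaryE xiB xiu'.
  apply: contrapT => nH; apply: xiomega; rewrite omegaE xiE''.
  apply: boundary_class_eq; apply: (boundary_equiv_cofinal (p := g 0)) => //.
    exact: converges_to_infinity_ray.
  (* The 1 pays for the error in [busemann_approx], and the [s] for the constant in [b]. *)
  move=> A N; apply: contrapT => nk; apply: nH; exists (2 * A + 1 - s), N => n nN.
  rewrite leNgt; apply/negP => /ltW h; apply: nk.
  have [T T0 HT] := busemann_approx (u' n) gg ltr01.
  have [k Hk] := nat_ge (Num.max T N%:R); exists n, k.
  move: Hk; rewrite ge_max => /andP[Tk Nk]; split => //; first by rewrite -(ler_nat R).
  rewrite /gromov_product /pos_seq.
  have := HT _ Tk; have := ray_dist gg (lexx 0) (le_trans T0 Tk).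
  rewrite (metric_sym (g 0)) (metric_sym (g k%:R) (u' n)) subr0 => -> /andP[_].
  move: h; rewrite bE; lra.
have [B1 [N1 H1]] := key u xiu; have [B2 [N2 H2]] := key v xiv.
move=> A; have [N HN] := boundary_equiv_cross (g 0) cu uv (A + (B1 + B2) / 2).
exists (maxn N (maxn N1 N2)) => n m; rewrite !geq_max => /and3P[n0 n1 n2] /and3P[m0 m1 m2].
have := HN n m n0 m0; have := H1 n n1; have := H2 m m2.
rewrite /gromov_product /gromov_product_at; lra.
Qed.

(** If [u] represented the basepoint at infinity, its large products with the ray would make
    [b (u n)] small compared with |u(n) g(0)|, whereas the product with a fixed term [u N0] bounds
    [b (u n)] from below. *)
Lemma hatB_pinfty_boundary u :
  (forall A : R, exists N, forall n m, (N <= n)%N -> (N <= m)%N ->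
    A <= gromov_product_at b (u n) (u m)) ->
  converges_to_infinity u /\ boundary_minus w (boundary_class u).
Proof.
move=> H; have cu : converges_to_infinity u.
  apply/(converges_to_infinityP (u 0%N)) => A; have [N HN] := H (A + b (u 0%N)).
  exists N => n m nN mN; have := HN n m nN mN.
  by have := gromov_product_at_le (u 0%N) (u n) (u m); lra.
split => //; move: bw; case: w => [z _|omega] /=; first by exists u.
move=> [g [s [gg omegaE bE]]]; split; first by exists u.
move=> uomega; have cg := converges_to_infinity_ray gg.
have ug : boundary_equiv u (pos_seq g).
  have : boundary_class u (pos_seq g).
    by rewrite uomega omegaE; split => //; exact: boundary_equiv_refl.
  by case.
have [N0 H0] := H 0.
(* This threshold yields b (u n) <= |u(n) u(N0)| - b (u N0) - 1, against the nonnegative product of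
   [u n] and [u N0]. *)
have [N1 H1] := boundary_equiv_cross (g 0) cu ug
  ((b (u N0) + mdist (u N0) (g 0) + s + 1) / 2).
pose n := maxn N0 N1.
have := H0 n N0 (leq_maxl _ _) (leqnn _); rewrite /gromov_product_at.
have [T T0 HT] := busemann_approx (u n) gg ltr01.
have [k Hk] := nat_ge (Num.max T N1%:R).
move: Hk; rewrite ge_max => /andP[Tk Nk].
have N1k : (N1 <= k)%N by rewrite -(ler_nat R).
have := H1 n k (leq_maxr _ _) N1k; rewrite /gromov_product /pos_seq.
have := HT _ Tk; have := ray_dist gg (lexx 0) (le_trans T0 Tk).
rewrite (metric_sym (g 0)) (metric_sym (g k%:R) (u n)) subr0 => -> /andP[h1 _].
have := metric_triangle (u n) (u N0) (g 0); rewrite (bE (u n)); lra.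
Qed.

End GromovSequences.

(** * Bounds on lower limits, and exponential inequalities solved for the exponent *)

Section ExtendedLimits.
Context {R : realType}.

Lemma limn_einf_ge (a : nat -> \bar R) (A : \bar R) N :
  (forall n, (N <= n)%N -> (A <= a n)%E) -> (A <= limn_einf a)%E.
Proof.
move=> H; rewrite limn_einf_lim; apply: lime_ge; first exact: is_cvg_einfs.
exists N => // n /= nN; apply: le_ereal_inf_tmp => _ [k /= nk <-].
exact/H/(leq_trans nN).
Qed.

Lemma limn_einf_le (a : nat -> \bar R) (A : \bar R) N :
  (forall n, (N <= n)%N -> (a n <= A)%E) -> (limn_einf a <= A)%E.
Proof.
move=> H; rewrite limn_einf_lim; apply: lime_le; first exact: is_cvg_einfs.
exists N => // n /= nN; apply: le_trans (H n nN).
by apply: ereal_inf_lbound; exists n => /=.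
Qed.

Lemma expRN_leE (e a v : R) : 0 < e -> 0 < v ->
  (expR (- e * a) <= v) = (- ln v / e <= a).
Proof.
move=> e0 v0; rewrite -{1}(lnK v0) ler_expR ler_pdivrMr// mulNr lerNl.
by rewrite mulrC.
Qed.

Lemma expRN_geE (e a v : R) : 0 < e -> 0 < v ->
  (v <= expR (- e * a)) = (a <= - ln v / e).
Proof.
move=> e0 v0; rewrite -{1}(lnK v0) ler_expR ler_pdivlMr// mulNr lerNr.
by rewrite mulrC.
Qed.

End ExtendedLimits.

(** * From the two-sided estimate of an abstract [d] to the boundary bijection and the visual
    metric *)

Section Visual.
Context {R : realType} {X : metricType R}.
Implicit Types (x y z : X) (u v : nat -> X) (xi zeta : set (nat -> X)).
Hypothesis cX : complete_space X.
Hypothesis gX : geodesic_space X.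
Hypothesis hypX : exists2 delta : R, 0 <= delta & hyperbolic X delta.
Variables (b : X -> R) (w : basepoint X).
Hypothesis bw : hatB_based b w.
Variables (d : X -> X -> R) (eps c1 c0 : R).
Hypotheses (d_ge0 : forall x y, 0 <= d x y) (dxx : forall x, d x x = 0)
  (d_sym : forall x y, d x y = d y x)
  (d_triangle : forall x y z, d x z <= d x y + d y z).
Hypotheses (eps0 : 0 < eps) (c1_gt0 : 0 < c1) (c0_gt0 : 0 < c0).
Hypothesis d_le : forall x y, d x y <= c1 * expR (- eps * gromov_product_at b x y).
Hypothesis d_ge : forall x y,
  c0 * expR (- eps * gromov_product_at b x y) * Num.min 1 (mdist x y) <= d x y.
Hypothesis d_local : forall x e, 0 < e -> exists2 eta, 0 < eta &
  forall y, mdist x y < eta -> d x y < e.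

Let bm := boundary_minus w.
Let cvg0 u v := d (u n) (v n) @[n --> \oo] --> (0 : R).

Lemma d_pinfty_small u v :
  (forall A : R, exists N, forall n m, (N <= n)%N -> (N <= m)%N ->
    A <= gromov_product_at b (u n) (v m)) ->
  forall e : R, 0 < e -> exists N, forall n m, (N <= n)%N -> (N <= m)%N ->
    d (u n) (v m) < e.
Proof.
move=> H e e0; have v0 : 0 < e / (2 * c1) by rewrite divr_gt0// mulr_gt0.
have [N HN] := H (- ln (e / (2 * c1)) / eps); exists N => n m nN mN.
apply: le_lt_trans (d_le _ _) _.
have := HN n m nN mN; rewrite -(expRN_leE _ eps0 v0) => h.
apply: (@le_lt_trans _ _ (c1 * (e / (2 * c1)))); first by rewrite ler_wpM2l// ltW.
rewrite (_ : c1 * _ = e / 2); last by field; rewrite gt_eqF.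
by rewrite ltr_pdivrMr// ltr_pMr// ltr1n.
Qed.

Lemma boundary_d_cauchy xi u : bm xi -> xi u -> d_cauchy d u.
Proof.
move=> xib xiu; apply/(d_cauchyP d_ge0); apply: d_pinfty_small.
exact: (hatB_boundary_pinfty gX hypX bw xib xiu xiu).
Qed.

Lemma boundary_d_cvg0 xi u v : bm xi -> xi u -> xi v -> cvg0 u v.
Proof.
move=> xib xiu xiv; apply/cvg_seq_ltP => e e0.
have [N HN] := d_pinfty_small (hatB_boundary_pinfty gX hypX bw xib xiu xiv) e0.
by exists N => n nN; rewrite sub0r normrN ger0_norm// HN.
Qed.

Lemma boundary_common_limit xi : bm xi -> exists! p, common_limit d xi p.
Proof.
move=> xib; have [u xiu] := gromov_boundary_ex (boundary_minus_boundary xib).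
apply: (common_limit_unique d_ge0 dxx d_sym d_triangle xiu) => [v v'|v].
  exact: boundary_d_cvg0.
exact: boundary_d_cauchy.
Qed.

Lemma boundary_mapE xi u : bm xi -> xi u -> canonical_map d xi = completion_class d u.
Proof.
move=> xib xiu.
apply: (canonical_mapE d_ge0 dxx d_sym d_triangle xiu) => [v v'|v].
  exact: boundary_d_cvg0.
exact: boundary_d_cauchy.
Qed.

Lemma boundary_map_completion xi : bm xi -> completion d (canonical_map d xi).
Proof.
move=> xib; have [u xiu] := gromov_boundary_ex (boundary_minus_boundary xib).
by rewrite (boundary_mapE xib xiu); exists u; split => //; exact: boundary_d_cauchy xib xiu.
Qed.

Lemma boundary_map_cvg xi zeta u v : bm xi -> bm zeta -> xi u -> zeta v ->
  d (u n) (v n) @[n --> \oo] -->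
    completion_dist d (canonical_map d xi) (canonical_map d zeta).
Proof.
move=> xib zetab xiu zetav; rewrite (boundary_mapE xib xiu) (boundary_mapE zetab zetav).
have cu := boundary_d_cauchy xib xiu; have cv := boundary_d_cauchy zetab zetav.
apply: completion_dist_cvg => //.
- by exists u.
- by exists v.
- exact: completion_class_self.
- exact: completion_class_self.
Qed.

(** A representing sequence is eventually at distance at least 1 from any [x], and its products with
    [x] are at most [b x]; by [d_ge] it stays at [d]-distance at least c0 e^(-eps b x) from [x]. *)
Lemma boundary_map_in xi : bm xi -> completion_boundary d (canonical_map d xi).
Proof.
move=> xib; split; first exact: boundary_map_completion.
have xiB := boundary_minus_boundary xib.
have [u xiu] := gromov_boundary_ex xiB.
have [cu _] := gromov_boundaryE gX hypX xiB xiu.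
rewrite (boundary_mapE xib xiu) => -[x _ xu].
have : completion_class d u u.
  by apply: completion_class_self => //; exact: boundary_d_cauchy xib xiu.
rewrite -xu => -[_ /cvg_seq_ltP xu0].
pose k := c0 * expR (- eps * b x); have k0 : 0 < k by rewrite mulr_gt0// expR_gt0.
have [N1 H1] := xu0 k k0; have [N2 H2] := converges_to_infinity_far x cu 1.
pose n := maxn N1 N2.
have := H1 n (leq_maxl _ _); rewrite sub0r normrN ger0_norm// => h.
have := d_ge x (u n); rewrite leNgt => /negP; apply; apply: lt_le_trans h _.
rewrite min_l; last by rewrite metric_sym H2// leq_maxr.
rewrite mulr1 ler_pM2l// ler_expR !mulNr lerN2 ler_pM2l//.
exact: (gromov_product_at_lel gX hypX bw).
Qed.

Lemma boundary_separated xi zeta u v : bm xi -> bm zeta -> xi u -> zeta v -> xi <> zeta ->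
  exists (A : R) N, forall n, (N <= n)%N ->
    1 <= mdist (u n) (v n) /\ gromov_product_at b (u n) (v n) <= A.
Proof.
move=> /boundary_minus_boundary xib /boundary_minus_boundary zetab xiu zetav xizeta.
have [cu xiE] := gromov_boundaryE gX hypX xib xiu.
have [cv zetaE] := gromov_boundaryE gX hypX zetab zetav.
have uv : ~ boundary_equiv u v.
  by move=> uv; apply: xizeta; rewrite xiE zetaE; exact: boundary_class_eq.
have [A [N H]] := not_boundary_equiv gX hypX (u 0%N) cu cv uv.
exists (A + b (u 0%N)), N => n nN; have [h1 h2] := H n nN; split => //.
by have := gromov_product_at_le gX hypX bw (u 0%N) (u n) (v n); lra.
Qed.

Lemma d_ge_far x y : 1 <= mdist x y ->
  c0 * expR (- eps * gromov_product_at b x y) <= d x y.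
Proof. by move=> xy; have := d_ge x y; rewrite min_l// mulr1. Qed.

Lemma boundary_dist_gt0 xi zeta : bm xi -> bm zeta -> xi <> zeta ->
  0 < completion_dist d (canonical_map d xi) (canonical_map d zeta).
Proof.
move=> xib zetab xizeta.
have [u xiu] := gromov_boundary_ex (boundary_minus_boundary xib).
have [v zetav] := gromov_boundary_ex (boundary_minus_boundary zetab).
have [A [N H]] := boundary_separated xib zetab xiu zetav xizeta.
apply: (@lt_le_trans _ _ (c0 * expR (- eps * A))); first by rewrite mulr_gt0// expR_gt0.
apply: ler_cvg_to (cvg_cst _) (boundary_map_cvg xib zetab xiu zetav) _.
exists N => // n /= nN; have [h1 h2] := H n nN.
apply: le_trans (d_ge_far h1).
by rewrite ler_pM2l// ler_expR !mulNr lerN2 ler_pM2l.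
Qed.

Lemma boundary_map_inj xi zeta : bm xi -> bm zeta ->
  completion_dist d (canonical_map d xi) (canonical_map d zeta) = 0 -> xi = zeta.
Proof.
move=> xib zetab h; apply: contrapT => xizeta.
by have := boundary_dist_gt0 xib zetab xizeta; rewrite h ltxx.
Qed.

Lemma complete_cauchy_seq u : (forall e : R, 0 < e ->
    exists N, forall m, (N <= m)%N -> mdist (u N) (u m) < e) ->
  exists x, u n @[n --> \oo] --> x.
Proof.
move=> cu; apply: cX; apply: cauchy_exP => e e0.
have [N HN] := cu e e0; exists (u N); apply: (@near_ooP _).2.
by exists N => n nN; rewrite ballEmdist; exact: HN.
Qed.

Lemma d_cauchy_pinfty u : d_cauchy d u -> (forall x, ~ cvg0 (fun=> x) u) ->
  forall A : R, exists N, forall n m, (N <= n)%N -> (N <= m)%N ->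
    A <= gromov_product_at b (u n) (u m).
Proof.
move=> /(d_cauchyP d_ge0) cu ncu.
(* Otherwise (u n|u m)_b <= b (u n) is bounded for cofinally many n, and [d_ge]
   makes u Cauchy in X. *)
have bpinfty (A : R) : exists N, forall n, (N <= n)%N -> A <= b (u n).
  apply: contrapT => nH.
  have cofinal N : exists2 n, (N <= n)%N & b (u n) <= A.
    apply: contrapT => nn; apply: nH; exists N => n nN; rewrite leNgt.
    by apply/negP => /ltW h; apply: nn; exists n.
  pose k := c0 * expR (- eps * A); have k0 : 0 < k by rewrite mulr_gt0// expR_gt0.
  have cuX (e : R) : 0 < e -> exists N, forall m, (N <= m)%N -> mdist (u N) (u m) < e.
    (* Since e' <= 1, the strict inequality min(1, |u(n) u(m)|) < e' rules out that the minimum is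
       1. *)
    move=> e0; pose e' := Num.min 1 e.
    have e'0 : 0 < e' by rewrite lt_min ltr01.
    have [N HN] := cu (k * e') (mulr_gt0 k0 e'0).
    have [n nN bn] := cofinal N; exists n => m nm.
    have := HN n m nN (leq_trans nN nm) => h.
    have h2 : k * Num.min 1 (mdist (u n) (u m)) < k * e'.
      apply: le_lt_trans h; apply: le_trans (d_ge _ _).
      rewrite ler_wpM2r ?le_min ?ler01 ?mdist_ge0//.
      rewrite ler_pM2l// ler_expR !mulNr lerN2 ler_pM2l//.
      exact: le_trans (gromov_product_at_lel gX hypX bw _ _) bn.
    move: h2; rewrite ltr_pM2l// gt_min => /orP[|]; rewrite /e' lt_min => /andP[//].
    by rewrite ltxx.
  have [x ux] := complete_cauchy_seq cuX.
  apply: (ncu x); apply/cvg_seq_ltP => e e0.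
  have [eta eta0 Heta] := d_local x e0.
  have [N HN] := (@near_ooP _).1 (metricType_numDomainType.cvgr_dist_lt ux eta0).
  by exists N => n nN; rewrite sub0r normrN ger0_norm// Heta// HN.
move=> A.
have [N1 H1] := bpinfty (A + 1).
have [N2 H2] := cu (c0 * expR (- eps * A)) (mulr_gt0 c0_gt0 (expR_gt0 _)).
exists (maxn N1 N2) => n m; rewrite !geq_max => /andP[n1 n2] /andP[m1 m2].
(* Terms at distance at least 1 have a large product by the lower estimate of [d]; terms at distance
   at most 1 have one because [b] is at least A + 1 at both. *)
have [far|/ltW near_] := leP 1 (mdist (u n) (u m)).
  have := le_lt_trans (d_ge_far far) (H2 n m n2 m2).
  by rewrite ltr_pM2l// ltr_expR !mulNr ltrN2 ltr_pM2l// => /ltW.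
have := H1 n n1; have := H1 m m1; rewrite /gromov_product_at; lra.
Qed.

Lemma boundary_map_surj p : completion_boundary d p ->
  exists2 xi, bm xi & canonical_map d xi = p.
Proof.
move=> [[u [cu pE]] pX].
have ncu x : ~ cvg0 (fun=> x) u.
  move=> h; apply: pX; exists x => //; rewrite pE.
  exact: completion_class_eq.
have [cui wu] := hatB_pinfty_boundary gX hypX bw (d_cauchy_pinfty cu ncu).
exists (boundary_class u) => //; rewrite pE; apply: boundary_mapE => //.
by split => //; exact: boundary_equiv_refl.
Qed.

Lemma boundary_map_bij : set_bij bm (completion_boundary d) (canonical_map d).
Proof.
split.
- exact: boundary_map_in.
- move=> xi zeta; rewrite !inE => xib zetab h; apply: boundary_map_inj => //.
  by rewrite h completion_distxx//; exact: boundary_map_completion.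
- by move=> p /boundary_map_surj[xi xib <-]; exists xi.
Qed.

Lemma boundary_metric : metric_on bm
  (fun xi zeta => completion_dist d (canonical_map d xi) (canonical_map d zeta)).
Proof.
split.
- by move=> *; apply: completion_dist_ge0 => //; exact: boundary_map_completion.
- move=> xi zeta xib zetab; split; first exact: boundary_map_inj.
  by move=> ->; apply: completion_distxx => //; exact: boundary_map_completion.
- by move=> *; apply: completion_dist_sym => //; exact: boundary_map_completion.
- move=> *; apply: completion_dist_triangle => //;
    exact: boundary_map_completion.
Qed.

Lemma model_quasimetric_self xi : bm xi -> model_quasimetric eps b xi xi = 0%E.
Proof.
move=> xib; rewrite /model_quasimetric (_ : gromov_product_bd b xi xi = +oo%E).
  by rewrite gt0_muley ?lte_fin.
apply/eqP; rewrite -leye_eq; apply: le_ereal_inf_tmp => _ [[u v] [/= xiu xiv] <-].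
rewrite leye_eq; apply/eqP/eqyP => A A0.
have [N HN] := hatB_boundary_pinfty gX hypX bw xib xiu xiv A.
by apply: (@limn_einf_ge _ _ _ N) => n nN; rewrite lee_fin HN.
Qed.

(** For every choice of representatives [d (u n) (v n)] is eventually between D / 2 and 2 D, so the
    products lie between two bounds that do not depend on the choice. These bounds pass to the lower
    limit and to the infimum, which is thus finite. *)
Lemma model_quasimetric_bounds xi zeta : bm xi -> bm zeta -> xi <> zeta ->
  let D := completion_dist d (canonical_map d xi) (canonical_map d zeta) in
  exists2 r, model_quasimetric eps b xi zeta = r%:E & D / (2 * c1) <= r <= 2 * D / c0.
Proof.
move=> xib zetab xizeta D; have D0 : 0 < D by exact: boundary_dist_gt0.
have lo0 : 0 < D / (2 * c1) by rewrite divr_gt0// mulr_gt0.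
have hi0 : 0 < 2 * D / c0 by rewrite divr_gt0// mulr_gt0.
(* The exponents at which e^(-eps A) equals 2 D / c0 and D / (2 c1). *)
pose A1 := - ln (2 * D / c0) / eps; pose A2 := - ln (D / (2 * c1)) / eps.
have key u v : xi u -> zeta v ->
    (A1%:E <= limn_einf (fun n => (gromov_product_at b (u n) (v n))%:E) <= A2%:E)%E.
  move=> xiu zetav.
  have [A [N1 H1]] := boundary_separated xib zetab xiu zetav xizeta.
  have D20 : 0 < D / 2 by rewrite divr_gt0.
  have [N2 H2] := (cvg_seq_ltP _ _).1 (boundary_map_cvg xib zetab xiu zetav) _ D20.
  have bounds n : (maxn N1 N2 <= n)%N ->
      A1 <= gromov_product_at b (u n) (v n) <= A2.
    rewrite geq_max => /andP[n1 n2]; have [far _] := H1 n n1.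
    have := H2 n n2; rewrite -/D ltr_norml => /andP[h1 h2].
    rewrite -(expRN_leE _ eps0 hi0) -(expRN_geE _ eps0 lo0); apply/andP; split.
      by rewrite ler_pdivlMr// mulrC; have := d_ge_far far; lra.
    rewrite invfM mulrA ler_pdivrMr// mulrC; have := d_le (u n) (v n); lra.
  apply/andP; split.
    by apply: limn_einf_ge => n /bounds/andP[h _]; rewrite lee_fin; exact: h.
  by apply: limn_einf_le => n /bounds/andP[_ h]; rewrite lee_fin; exact: h.
have bdA : (A1%:E <= gromov_product_bd b xi zeta <= A2%:E)%E.
  apply/andP; split.
    by apply: le_ereal_inf_tmp => _ [[u v] [/= xiu zetav] <-]; case/andP: (key u v xiu zetav).
  have [u xiu] := gromov_boundary_ex (boundary_minus_boundary xib).
  have [v zetav] := gromov_boundary_ex (boundary_minus_boundary zetab).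
  case/andP: (key u v xiu zetav) => _; apply: le_trans.
  by apply: ereal_inf_lbound; exists (u, v).
move: bdA; rewrite /model_quasimetric.
case: (gromov_product_bd b xi zeta) => [r| |]; last 2 first.
- by rewrite leye_eq andbF.
- by rewrite leeNy_eq.
rewrite !lee_fin => /andP[h1 h2]; exists (expR (- eps * r)); first by rewrite mulNr.
by rewrite (expRN_leE _ eps0 hi0) (expRN_geE _ eps0 lo0) h1 h2.
Qed.

Lemma boundary_visual_metric (L : R) : 2 * c1 <= L -> 2 / c0 <= L -> visual_metric eps b w L
  (fun xi zeta => completion_dist d (canonical_map d xi) (canonical_map d zeta)).
Proof.
move=> L1 L2; split; first exact: boundary_metric.
have L0 : 0 < L by apply: lt_le_trans L1; rewrite mulr_gt0.
move=> xi zeta xib zetab; have [<-|/eqP xizeta] := eqVneq xi zeta.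
  rewrite (model_quasimetric_self xib) !mule0 completion_distxx//.
  exact: boundary_map_completion.
have D0 := boundary_dist_gt0 xib zetab xizeta.
have [r -> /andP[h1 h2]] := model_quasimetric_bounds xib zetab xizeta.
have r0 : 0 < r by apply: lt_le_trans h1; rewrite divr_gt0// mulr_gt0.
rewrite -!EFinM !lee_fin; split.
  rewrite ler_pdivrMl//; apply: le_trans h2 _.
  by rewrite mulrAC ler_wpM2r// ltW.
move: h1; rewrite ler_pdivrMr ?mulr_gt0// mulrC => h1; apply: le_trans h1 _.
by rewrite ler_wpM2r// ltW.
Qed.

End Visual.

Theorem theorem1p6 (R : realType) (delta K eps M : R)
    (delta_ge0 : 0 <= delta) (K_ge0 : 0 <= K) (eps_gt0 : 0 < eps) (M_ge1 : 1 <= M) :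
  exists L : R, 1 <= L /\
  forall (X : metricType R) (b : X -> R) (w : basepoint X),
    complete_space X -> geodesic_space X -> hyperbolic X delta ->
    hatB_based b w -> roughly_starlike K w ->
    GH_density (rho_eps eps b) M ->
    let d := rho_dist (rho_eps eps b) in
    let phi := canonical_map d in
    [/\ forall xi, boundary_minus w xi -> exists! p, common_limit d xi p,
        set_bij (boundary_minus w) (completion_boundary d) phi &
        visual_metric eps b w L
          (fun xi zeta => completion_dist d (phi xi) (phi zeta))].
Proof.
(* [C] is the horolike constant of [b]; [c0] collects the GH constant and the loss C + 1 in the
   exponent of the lower estimate. *)
pose C := 4 * (delta + 2); pose c1 := 2 * eps^-1.
pose c0 := M^-1 * expR (- eps * (C + 1)).
have M0 : 0 < M by apply: lt_le_trans M_ge1.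
have c10 : 0 < c1 by rewrite mulr_gt0// invr_gt0.
have c00 : 0 < c0 by rewrite mulr_gt0 ?invr_gt0// expR_gt0.
exists (Num.max 1 (Num.max (2 * c1) (2 / c0))); split; first by rewrite le_max lexx.
move=> X b w cX gX hX bw _ GH d phi.
have hypX : exists2 delta : R, 0 <= delta & hyperbolic X delta by exists delta.
have hb : horolike C b := horolike_hatB gX delta_ge0 hX bw.
have [bL _] := hb; have [[crho rho0] _] := GH.
have d_ge0 := rho_dist_ge0 crho rho0 gX.
have dxx := rho_dist_xx crho rho0 gX.
have d_sym := rho_dist_sym crho rho0 gX.
have d_triangle := rho_dist_triangle crho rho0 gX.
have d_le x y := rho_dist_le_gromov gX x y eps_gt0 crho bL.
have d_ge x y : c0 * expR (- eps * gromov_product_at b x y) * Num.min 1 (mdist x y) <= d x y.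
  have := rho_dist_ge_gromov gX x y eps_gt0 GH hb; rewrite -/d -ler_pdivrMl//.
  by rewrite -addrA mulrDr expRD /c0 !mulrA [M^-1 * _ * _ in X in _ -> X]mulrAC.
have d_local x e : 0 < e -> exists2 eta, 0 < eta & forall y, mdist x y < eta -> d x y < e.
  (* [k] bounds the density on the unit ball around [x], where [b] is at least b x - 1. *)
  move=> e0; pose k := expR (- eps * (b x - 1)); have k0 : 0 < k by exact: expR_gt0.
  exists (Num.min 1 (e / k)); first by rewrite lt_min ltr01 divr_gt0.
  move=> y; rewrite lt_min => /andP[/ltW xy1 xye].
  apply: le_lt_trans (rho_dist_le_mdist gX x y eps_gt0 crho bL) _.
  apply: (@le_lt_trans _ _ (k * mdist x y)); last by rewrite mulrC -ltr_pdivlMr.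
  rewrite ler_wpM2r ?mdist_ge0// ler_expR !mulNr lerN2 ler_pM2l//; lra.
split.
- exact: (boundary_common_limit gX hypX bw d_ge0 dxx d_sym d_triangle eps_gt0 c10 d_le).
- exact: (boundary_map_bij cX gX hypX bw d_ge0 dxx d_sym d_triangle eps_gt0 c10 c00
    d_le d_ge d_local).
- apply: (boundary_visual_metric gX hypX bw d_ge0 dxx d_sym d_triangle eps_gt0 c10 c00
    d_le d_ge).
  + by rewrite !le_max lexx orbT.
  + by rewrite !le_max lexx !orbT.
Qed.
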